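(* Let $\mathcal{X}$ and $\mathcal{Y}$ be Polish spaces, let $\mathcal{S}=\{\mu_1,\ldots,\mu_{|\mathcal{S}|}\}$ be a finite set of probability measures on $\mathcal{X}$, and let $Q$ be a conditional distribution (stochastic kernel) from $\mathcal{X}$ to $\mathcal{Y}$. For each $\alpha\in\{1,\ldots,|\mathcal{S}|\}$ let $(X_\alpha,Y_\alpha)\sim\mu_\alpha\otimes Q$, and assume $I(X_\alpha;Y_\alpha)<\infty$ for all $\alpha$. Then there exist a random variable $Z$ and a deterministic (measurable) function $g$ such that, for every $\alpha\in\{1,\ldots,|\mathcal{S}|\}$, $Z$ is independent of $X_\alpha$, $Y_\alpha$ can be expressed as $Y_\alpha=g(X_\alpha,Z)$ (i.e. $(X_\alpha,g(X_\alpha,Z))\sim\mu_\alpha\otimes Q$), and $$H(Y_\alpha\mid Z)\le \bar{I}(\mathcal{S},Q)+\log\big(|\mathcal{S}|\cdot(\bar{I}(\mathcal{S},Q)+1)\big)+4 .$$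
   Context: A conditional distribution (stochastic kernel) $Q$ from $\mathcal{X}$ to $\mathcal{Y}$ is a map $x\mapsto Q(\cdot|x)$ into probability measures on $\mathcal{Y}$ such that $x\mapsto Q(A|x)$ is measurable for every measurable $A\subseteq\mathcal{Y}$. For a probability measure $\mu$ on $\mathcal{X}$, $\mu\otimes Q$ denotes the joint law of $(X,Y)$ with $X\sim\mu$ and $Y|X=x\sim Q(\cdot|x)$, and $I(\mu,Q)$ denotes the mutual information of $(X,Y)\sim\mu\otimes Q$. For a set $\mathcal{S}$ of probability measures on $\mathcal{X}$, $\bar{I}(\mathcal{S},Q)=\sup_{\mu\in\mathcal{S}}I(\mu,Q)$. $H(\cdot\mid\cdot)$ is (discrete) conditional entropy; logarithms and entropies are in bits. *)

(* Defs.v *)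
From HB Require Import structures.
From mathcomp Require Import all_boot all_order all_algebra.
From mathcomp Require Import all_classical all_reals all_analysis.

Set Implicit Arguments.
Unset Strict Implicit.
Unset Printing Implicit Defensive.

Import Order.TTheory GRing.Theory Num.Theory.
Local Open Scope classical_set_scope.
Local Open Scope ring_scope.

Section defs.
Context (R : realType).

Definition log2 (x : R) : R := ln x / ln 2.

Definition is_metric (T : Type) (dist : T -> T -> R) : Prop :=
  [/\ (forall x y, 0 <= dist x y),
      (forall x y, dist x y = 0 <-> x = y),
      (forall x y, dist x y = dist y x) &
      (forall x y z, dist x z <= dist x y + dist y z)].

Definition metric_open (T : Type) (dist : T -> T -> R) (A : set T) : Prop :=
  forall x, A x -> exists2 e : R, 0 < e & forall y, dist x y < e -> A y.

Definition metric_complete (T : Type) (dist : T -> T -> R) : Prop :=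
  forall u : nat -> T,
    (forall e : R, 0 < e -> exists N, forall m n, (N <= m)%N -> (N <= n)%N ->
       dist (u m) (u n) < e) ->
    exists l : T, forall e : R, 0 < e -> exists N, forall n, (N <= n)%N ->
       dist (u n) l < e.

Definition metric_separable (T : Type) (dist : T -> T -> R) : Prop :=
  exists D : set T, countable D /\
    forall x (e : R), 0 < e -> exists2 y, D y & dist x y < e.

Definition polish_space d (T : measurableType d) : Prop :=
  exists dist : T -> T -> R,
    [/\ is_metric dist, metric_complete dist, metric_separable dist &
        (@measurable d T = <<s metric_open dist >>)].

Local Open Scope ereal_scope.

Context {dX dY : measure_display} {X : measurableType dX}
        {Y : measurableType dY}.

Definition joint_rect (mu : {measure set X -> \bar R})
  (Q : X -> {measure set Y -> \bar R}) (A : set X) (B : set Y) : \bar R :=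
  \int[mu]_(x in A) Q x B.

Definition joint_law (mu : {measure set X -> \bar R})
  (Q : X -> {measure set Y -> \bar R}) (C : set (X * Y)) : \bar R :=
  \int[mu]_x Q x (xsection C x).

Definition output_law (mu : {measure set X -> \bar R})
  (Q : X -> {measure set Y -> \bar R}) (B : set Y) : \bar R :=
  \int[mu]_x Q x B.

Definition finite_partition d (T : measurableType d) (k : nat)
  (A : 'I_k -> set T) : Prop :=
  [/\ (forall i, measurable (A i)),
      (forall i j, i != j -> A i `&` A j = set0) &
      \bigcup_(i in [set: 'I_k]) A i = [set: T]].

Definition mi_term (p a b : R) : R :=
  if p == 0%R then 0%R else (p * log2 (p / (a * b)))%R.

(** Mutual information I(mu,Q) of (X,Y) ~ mu (x) Q, in the general
    (Gelfand-Yaglom-Dobrushin) sense: supremum of the mutual information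
    of finite measurable quantizations of X and Y. *)
Definition mutual_info (mu : {measure set X -> \bar R})
  (Q : X -> {measure set Y -> \bar R}) : \bar R :=
  ereal_sup [set r | exists (k l : nat) (A : 'I_k -> set X) (B : 'I_l -> set Y),
     [/\ finite_partition A, finite_partition B &
       r = (\sum_(i < k) \sum_(j < l)
              mi_term (fine (joint_rect mu Q (A i) (B j)))
                      (fine (mu (A i)))
                      (fine (output_law mu Q (B j))))%:E]].

End defs.

Section entropy.
Context (R : realType) {dY : measure_display} {Y : measurableType dY}.
Local Open Scope ereal_scope.

Definition atoms (nu : set Y -> \bar R) : set Y := [set y | 0 < nu [set y]].

Definition entropy (nu : set Y -> \bar R) : \bar R :=
  if (\esum_(y in atoms nu) nu [set y]) == 1 then
    \esum_(y in atoms nu) (- (fine (nu [set y]) * log2 (fine (nu [set y]))))%:E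
  else +oo.

(** Conditional entropy H(Y|Z) when Y = g(X,Z) with X ~ mu independent of
    Z ~ PZ: conditionally on Z = z, Y has law mu o g(.,z)^-1, and
    H(Y|Z) = int H(law of Y given Z = z) PZ(dz). *)
Definition cond_entropy_fr {dX dZ : measure_display} {X : measurableType dX}
  {Z : measurableType dZ} (mu : {measure set X -> \bar R})
  (PZ : {measure set Z -> \bar R}) (g : X * Z -> Y) : \bar R :=
  \int[PZ]_z entropy (pushforward mu (fun x => g (x, z))).

End entropy.

(* Main.v *)
(** Let [n] be the number of input laws and [rho] the average of their output laws.
    Finite mutual information makes the joint laws absolutely continuous with respect to
    the products of their marginals, hence [Q x] has a density [f (x, _)] with respect
    to [rho] for almost every [x], simultaneously for all input laws.  Let [Z] be an
    i.i.d. sequence of points of law [rho], each carrying an independent uniform mark.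
    Given [x], read the sequence and accept the [i]th point greedily, so that the
    accepted masses fill the region under [f (x, _)] layer by layer; [g (x, z)] is the
    first accepted point, and its law is [Q x].

    If [K] is the index of that point, a convexity argument bounds the expectation of
    [ln (1 + K / n)] given [x] by the integral of [n * Psi (f (x, y) / n)] plus 1/2, where
    [Psi p] behaves like [p * ln p].  The output law of each input law has a density at
    most [n] with respect to [rho], so the Donsker-Varadhan inequality turns this into
    the bound [I * ln 2 + 17 / 16], hence into [L := Ibar + 8 / 5] in bits.  Given [Z], the
    output is a function of [K], and Gibbs' inequality with weights proportional to
    [(1 + i / n) ^ (- (1 + 1 / L))] bounds its entropy. *)
Require Import Defs.
From HB Require Import structures.
From mathcomp Require Import all_boot all_order all_algebra.
From mathcomp Require Import all_classical all_reals all_analysis.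
From mathcomp Require Import measurable_realfun ring lra.
Import Order.TTheory GRing.Theory Num.Theory.
Import numFieldNormedType.Exports.
Set Implicit Arguments.
Unset Strict Implicit.
Unset Printing Implicit Defensive.
Local Open Scope classical_set_scope.
Local Open Scope ring_scope.

(** * Independent identically distributed sequences *)

(** [Z] must serve every input law at once, so its points are drawn from the average output law and
    the acceptance rule never sees which input law is in force. The price is a factor [n] between
    each output law and [rho]. Counting the index in units of [n] puts this factor into the
    normalization [n * (1 + L)] of the weights, where its logarithm is paid once instead of
    [1 + 1 / L] times.

    The mutual information is a supremum over finite partitions and comes with no density. A single
    variational inequality serves twice: tested on large multiples of an indicator it gives absolute
    continuity, and tested on the logarithm of [f] over the output density it gives the cost bound.
    It is linear in the expectations, so relative entropy is never defined.

    The 17/16 nats are 1/2 from summing over the rounds, 1/2 from the gap between [Psi p] and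
    [p * ln p], and 1/16 from truncating a logarithm below at [ln (1/16)]. *)

Definition coord_sets {d} (V : measurableType d) : set (set (nat -> V)) :=
  [set A | exists i B, measurable B /\ A = (fun w => w i) @^-1` B].

Section mprob.
Context d (T : measurableType d) (R : realType) (m : {measure set T -> \bar R}).

(** The proof of total mass 1 is an argument of the alias, so that a probability structure can be
    attached to it. *)
Definition mprob of m setT = 1%E : set T -> \bar R := m.

Variable m1 : m setT = 1%E.
HB.instance Definition _ := Measure.copy (mprob m1) m.
HB.instance Definition _ := Measure_isProbability.Build _ _ _ (mprob m1) m1.

End mprob.

Arguments coord_sets {d} V _.

Notation seq_space V := (g_sigma_algebraType (coord_sets V)).

Section sequence_space.
Context {d : measure_display} (V : measurableType d).
Local Notation seqT := (seq_space V).

Lemma measurable_coord i : measurable_fun [set: seqT] (fun w : seqT => w i).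
Proof.
by move=> _ B mB; rewrite setTI; apply: sub_sigma_algebra; exists i, B.
Qed.

Lemma measurable_to_seq_space d' (T : measurableType d') (f : T -> seqT) :
  (forall i, measurable_fun [set: T] (fun t => f t i)) ->
  measurable_fun [set: T] f.
Proof.
move=> mf; apply: (@measurability _ _ T seqT setT f (coord_sets V)) => //.
move=> _ [_ [i [B [mB ->]]] <-]; exact: mf.
Qed.

Definition scons (v : V) (w : seqT) : seqT := fun i => if i is j.+1 then w j else v.

Lemma measurable_scons d' (T : measurableType d') (f : T -> V) (g : T -> seqT) :
  measurable_fun [set: T] f -> measurable_fun [set: T] g ->
  measurable_fun [set: T] (fun t => scons (f t) (g t)).
Proof.
move=> mf mg; apply: measurable_to_seq_space => -[|j] //=.
by apply: (measurableT_comp (measurable_coord j) mg).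
Qed.

Definition ssection (v : V) (A : set seqT) : set seqT := [set w | A (scons v w)].

Lemma measurable_ssection v A : measurable A -> measurable (ssection v A).
Proof.
move=> mA; rewrite -[ssection v A]setTI.
by apply: (@measurable_scons _ _ (cst v) id) => //; exact: measurable_id.
Qed.

Definition depends (n : nat) (A : set seqT) :=
  forall w w' : seqT, (forall i, (i < n)%N -> w i = w' i) -> A w -> A w'.

Lemma depends_leq m n A : (m <= n)%N -> depends m A -> depends n A.
Proof. by move=> mn h w w' ww'; apply: h => i im; apply: ww'; apply: leq_trans mn. Qed.

Lemma depends_ssection n v A : depends n.+1 A -> depends n (ssection v A).
Proof. by move=> h w w' ww'; apply: h => -[|i]//=; rewrite ltnS; exact: ww'. Qed.

Lemma dependsC n A : depends n A -> depends n (~` A).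
Proof. by move=> h w w' ww' nA /h A'; apply: nA; apply: A' => i im; rewrite ww'. Qed.

Lemma dependsU n A B : depends n A -> depends n B -> depends n (A `|` B).
Proof. by move=> hA hB w w' ww' [/(hA _ _ ww')|/(hB _ _ ww')]; [left|right]. Qed.

End sequence_space.

(** * Finite-dimensional laws and decreasing sequences of cylinders *)

Section finite_dimensional.
Context {d : measure_display} (V : measurableType d) (R : realType).
Variable P : probability V R.
Local Open Scope ereal_scope.

(** Iterated integral over the first [n] coordinates, the others being frozen at [point]; it is the
    product probability of [A] once [A] depends on these coordinates only. Recursion on sections
    makes it easy to fix the first coordinate. *)
Fixpoint fdprob (n : nat) (A : set (seq_space V)) : \bar R :=
  if n is n'.+1 then \int[P]_v fdprob n' (ssection v A)
  else (\1_A (point : seq_space V))%:E.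

Lemma fdprob_ge0 n A : 0 <= fdprob n A.
Proof.
elim: n A => [|n IH] A /=; first by rewrite lee_fin.
by apply: integral_ge0 => v _.
Qed.

Lemma measurable_fdprob_section n : forall d' (T : measurableType d')
  (C : set (T * seq_space V)), measurable C ->
  measurable_fun [set: T] (fun t => fdprob n (xsection C t)).
Proof.
elim: n => [|n IH] d' T C mC /=.
- apply/measurable_EFinP.
  have -> : (fun t => \1_(xsection C t) (point : seq_space V) : R)
          = (\1_C \o (fun t => (t, point : seq_space V))).
    by apply/funext => t /=; rewrite !indicE mem_xsection.
  apply: measurableT_comp; first exact: measurable_indic.
  exact: measurable_fun_pair.
- pose C' : set ((T * V) * seq_space V) := [set p | C (p.1.1, scons p.1.2 p.2)].
  have mC' : measurable C'.
    rewrite -[C']setTI; pose g := (fun p : (T * V) * seq_space V => (p.1.1, scons p.1.2 p.2)).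
    have mg : measurable_fun setT g.
      apply: measurable_fun_pair.
        exact: (measurableT_comp measurable_fst measurable_fst).
      apply: measurable_scons; last exact: measurable_snd.
      exact: (measurableT_comp measurable_snd measurable_fst).
    exact: mg.
  have := IH _ _ _ mC' => /= h.
  rewrite (_ : (fun t => _) =
     (fun t => \int[P]_v (fun p => fdprob n (xsection C' p)) (t, v))); last first.
    apply/funext => t; apply: eq_integral => v _; congr (fdprob n _).
  apply: (@measurable_fun_fubini_tonelli_F _ _ _ _ _ P
     (fun p => fdprob n (xsection C' p))) => //.
  by move=> p; exact: fdprob_ge0.
Qed.

Lemma measurable_fdprob_ssection n A : measurable A ->
  measurable_fun [set: V] (fun v => fdprob n (ssection v A)).
Proof.
move=> mA; pose C : set (V * seq_space V) := [set p | A (scons p.1 p.2)].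
have mC : measurable C.
  rewrite -[C]setTI; exact: (measurable_scons measurable_fst measurable_snd).
rewrite (_ : (fun v => _) = (fun v => fdprob n (xsection C v))).
  exact: measurable_fdprob_section.
by apply/funext => v; congr fdprob; apply/seteqP; split=> w; rewrite /xsection /= inE.
Qed.

Lemma fdprobU n A B : measurable A -> measurable B -> A `&` B = set0 ->
  fdprob n (A `|` B) = fdprob n A + fdprob n B.
Proof.
elim: n A B => [|n IH] A B mA mB AB /=.
  rewrite -EFinD !indicE in_setU; congr EFin.
  have : ~ (point \in A /\ point \in B).
    by rewrite !inE => -[pA pB]; have : set0 (point : seq_space V) by rewrite -AB.
  by case: (point \in A); case: (point \in B) => //= h; rewrite ?addr0 ?add0r //; case: h.
rewrite -ge0_integralD //; first last.
- exact: measurable_fdprob_ssection.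
- by move=> v _; exact: fdprob_ge0.
- exact: measurable_fdprob_ssection.
- by move=> v _; exact: fdprob_ge0.
apply: eq_integral => v _; rewrite -IH //; try exact: measurable_ssection.
by apply/seteqP; split=> w // -[wA wB]; have : set0 (scons v w) by rewrite -AB.
Qed.

Lemma fdprobT n : fdprob n setT = 1.
Proof.
elim: n => [|n IH] /=; first by rewrite indicT.
rewrite (eq_integral (cst 1)); first by rewrite integral_cst //= probability_setT mule1.
by move=> v _; rewrite -[RHS]IH; congr fdprob.
Qed.

Lemma fdprob0 n : fdprob n set0 = 0.
Proof.
elim: n => [|n IH] /=; first by rewrite indic0.
by rewrite (eq_integral (cst 0)) ?integral0 // => v _; rewrite -[RHS]IH; congr fdprob.
Qed.

Lemma le_fdprob n A B : measurable A -> measurable B -> A `<=` B ->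
  fdprob n A <= fdprob n B.
Proof.
move=> mA mB AB; rewrite -(setDUK AB) fdprobU ?setDIK //; last exact: measurableD.
by rewrite leeDl // fdprob_ge0.
Qed.

Lemma fdprob_le1 n A : measurable A -> fdprob n A <= 1.
Proof. by move=> mA; rewrite -(fdprobT n) le_fdprob. Qed.

Lemma fdprobS n A : depends n A -> fdprob n.+1 A = fdprob n A.
Proof.
elim: n A => [|n IH] A dA.
  rewrite /= (eq_integral (cst (\1_A (point : seq_space V))%:E)) => [|v _].
    by rewrite integral_cst //= probability_setT mule1.
  have dA' (w w' : seq_space V) : A w -> A w' by exact: dA.
  suff h : ((point : seq_space V) \in ssection v A) = ((point : seq_space V) \in A).
    by rewrite /cst !indicE h.
  by apply/idP/idP; rewrite !inE; exact: dA'.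
rewrite [LHS]/= [RHS]/=; apply: eq_integral => v _.
by apply: IH; exact: depends_ssection.
Qed.

Lemma fdprob_depends m n A : (m <= n)%N -> depends m A -> fdprob n A = fdprob m A.
Proof.
move=> /subnKC <-; elim: (n - m)%N => [|k IH] dA; first by rewrite addn0.
by rewrite addnS fdprobS ?IH //; apply: depends_leq dA; rewrite leq_addr.
Qed.

(** Any admissible [n] gives the same value, by [fdprob_depends]; a set function free of [n] is what
    countable additivity speaks about. *)
Definition cylprob (A : set (seq_space V)) : \bar R :=
  fdprob (xget 0%N [set n | depends n A]) A.

Lemma cylprobE n A : depends n A -> cylprob A = fdprob n A.
Proof.
move=> dA; rewrite /cylprob; case: xgetP => [m _ dm|/(_ n)//].
have [mn|/ltnW nm] := leqP m n; first by rewrite (fdprob_depends mn).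
by rewrite (fdprob_depends nm).
Qed.

Lemma cylprob_ssection n A : depends n.+1 A -> cylprob A = \int[P]_v cylprob (ssection v A).
Proof.
move=> dA; rewrite (cylprobE dA) /=; apply: eq_integral => v _.
by rewrite (cylprobE (depends_ssection dA)).
Qed.

Lemma fdprob_rect N (B : nat -> set V) : (forall i, measurable (B i)) ->
  fdprob N [set w | forall i, (i < N)%N -> B i (w i)] = \prod_(i < N) P (B i).
Proof.
elim: N B => [|N IH] B mB.
  rewrite /= big_ord0 indicE (_ : (_ \in _) = true) //; exact/mem_set.
rewrite big_ord_recl [LHS]/=.
rewrite (eq_integral (fun v => \prod_(i < N) P (B i.+1) * (\1_(B 0%N) v)%:E)); last first.
  move=> v _; rewrite -(IH (fun i => B i.+1)) // indicE.
  case: (boolP (v \in B 0%N)) => vB /=.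
    rewrite mule1; congr fdprob; apply/seteqP; split => w.
      by move=> wB i iN; exact: (wB i.+1).
    by move=> wB [|i] iN //=; [rewrite inE in vB|exact: wB].
  rewrite mule0 -(fdprob0 N); congr fdprob; apply/seteqP; split => w //.
  by move=> /(_ 0%N erefl) /= vB'; rewrite notin_setE in vB.
rewrite ge0_integralZl //.
- by rewrite integral_indic // setIT muleC.
- exact/measurable_EFinP/measurable_indic.
- by apply: prode_ge0 => i _; exact: measure_ge0.
Qed.

(** Sections have mass at most 1, so a total mass [e] forces the first coordinates whose section has
    mass at least [e / 2] to have probability at least [e / 2]. These sets of coordinates decrease
    with [n], so their intersection is not empty. *)
Lemma exists_ssection (C : nat -> set (seq_space V)) (e : R) : (0 < e)%R ->
  (forall n, measurable (C n)) -> (forall n, exists k, depends k (C n)) ->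
  (forall n, C n.+1 `<=` C n) -> (forall n, e%:E <= cylprob (C n)) ->
  exists v, forall n, (e / 2)%:E <= cylprob (ssection v (C n)).
Proof.
move=> e0 mC dC ndC eC.
have dC1 n : exists k, depends k.+1 (C n).
  by have [k dk] := dC n; exists k; apply: depends_leq dk.
have mcyl n : measurable_fun setT (fun v => cylprob (ssection v (C n))).
  have [k dk] := dC1 n.
  rewrite (_ : (fun v => _) = (fun v => fdprob k (ssection v (C n)))).
    exact: measurable_fdprob_ssection.
  by apply/funext => v; rewrite (cylprobE (depends_ssection dk)).
pose F n := [set v | (e / 2)%:E <= cylprob (ssection v (C n))].
have mF n : measurable (F n).
  rewrite -[F n]setTI; apply: emeasurable_fun_c_infty => //.
have e20 : (0 < e / 2)%R by rewrite divr_gt0.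
have PF n : (e / 2)%:E <= P (F n).
  have [k dk] := dC1 n.
  have h v : cylprob (ssection v (C n)) <= (e / 2)%:E + (\1_(F n) v)%:E.
    rewrite indicE; case: (boolP (v \in F n)) => vF /=.
      apply: (@le_trans _ _ 1).
        by rewrite (cylprobE (depends_ssection dk)) fdprob_le1 //; exact: measurable_ssection.
      by rewrite leeDr // lee_fin ltW.
    rewrite adde0; move: vF; rewrite notin_setE /F /= => /negP; rewrite -ltNge.
    exact: ltW.
  have : e%:E <= \int[P]_v ((e / 2)%:E + (\1_(F n) v)%:E).
    apply: le_trans (eC n) _; rewrite (cylprob_ssection dk).
    apply: ge0_le_integral => //.
    - by move=> v _; exact: fdprob_ge0.
    - apply/measurable_EFinP; apply: measurable_funD => //.
  rewrite ge0_integralD //; first last.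
  - exact/measurable_EFinP/measurable_indic.
  - by move=> v _; rewrite lee_fin ltW.
  rewrite integral_cst //= probability_setT mule1 integral_indic // setIT.
  rewrite [X in X%:E <= _](splitr e) EFinD leeD2lE //.
have ndF : nonincreasing_seq F.
  apply/nonincreasing_seqP => n; apply/subsetPset => v; rewrite /F /= => /le_trans; apply.
  have [k dk] := dC1 n; have [l dl] := dC1 n.+1.
  rewrite (cylprobE (depends_leq (leq_maxl k l) (depends_ssection dk))).
  rewrite (cylprobE (depends_leq (leq_maxr k l) (depends_ssection dl))).
  apply: le_fdprob; try exact: measurable_ssection.
  by move=> w; exact: ndC.
have mcap : measurable (\bigcap_n F n) by exact: bigcap_measurable.
have : (e / 2)%:E <= P (\bigcap_n F n).
  have P0 : P (F 0%N) < +oo by rewrite ltey_eq fin_num_measure.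
  have cv := nonincreasing_cvg_mu P0 mF mcap ndF.
  rewrite -(cvg_lim _ cv) //; apply: lime_ge; first by apply/cvg_ex; eexists; exact: cv.
  by apply: nearW => n; exact: PF.
have [->|/set0P[v vF] _] := eqVneq (\bigcap_n F n) set0.
  by rewrite measure0 lee_fin leNgt e20.
by exists v => n; exact: (vF n).
Qed.

(** Coordinates are fixed one at a time, in place of a compactness argument. The lower bound on the
    mass is halved at each stage but stays positive, and each [C n] is decided after finitely many
    stages. *)
Lemma bigcap_cylinders_neq0 (C : nat -> set (seq_space V)) (e : R) : (0 < e)%R ->
  (forall n, measurable (C n)) -> (forall n, exists k, depends k (C n)) ->
  (forall n, C n.+1 `<=` C n) -> (forall n, e%:E <= cylprob (C n)) ->
  exists w, forall n, C n w.
Proof.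
move=> e0 mC dC ndC eC.
pose good (D : nat -> set (seq_space V)) := [/\ forall n, measurable (D n),
  forall n, exists k, depends k (D n), forall n, D n.+1 `<=` D n &
  exists2 e : R, (0 < e)%R & forall n, e%:E <= cylprob (D n)].
have gC : good C by split=> //; exists e.
have step (D : {D | good D}) : {v : V | good (fun n => ssection v (sval D n))}.
  apply: cid; case: D => D [mD dD ndD [e' e'0 eD]] /=.
  have [v hv] := exists_ssection e'0 mD dD ndD eD.
  exists v; split=> //.
  - by move=> n; exact: measurable_ssection.
  - move=> n; have [k dk] := dD n; exists k.
    by apply: depends_ssection; apply: depends_leq dk.
  - by move=> n w; exact: ndD.
  - by exists (e' / 2)%R => //; rewrite divr_gt0.
pose next (D : {D | good D}) : {D | good D} := 
  exist good _ (svalP (step D)).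
pose S k := iter k next (exist _ _ gC).
pose w : seq_space V := fun k => sval (step (S k)).
pose pre k (u : seq_space V) : seq_space V := fun i => if (i < k)%N then w i else u (i - k)%N.
have preS k u : pre k (scons (w k) u) = pre k.+1 u.
  apply/funext => i; rewrite /pre ltnS; case: ltngtP => //= [ki|->].
    by rewrite -[(i - k)%N]prednK ?subn_gt0 //= -subnS.
  by rewrite subnn.
have Spre k n u : sval (S k) n u <-> C n (pre k u).
  elim: k u => [|k IH] u.
    rewrite (_ : pre 0%N u = u) //; apply/funext => i.
    by rewrite /pre ltn0 subn0.
  by rewrite -preS -IH.
exists w => n; have [k dk] := dC n.
have [_ _ _ [e' e'0 eS]] := svalP (S k).
(* Positive mass yields a tail [u] that completes the first [k] coordinates of [w] inside [C n], and
   [C n] reads no further coordinate. *)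
have [S0|/set0P[u /Spre]] := eqVneq (sval (S k) n) set0.
  have := eS n; rewrite S0 (@cylprobE 0%N) ?fdprob0 // => h.
  by move: e'0; rewrite -lte_fin => /lt_le_trans => /(_ _ h); rewrite ltxx.
by apply: dk => i ik; rewrite /pre ik.
Qed.

Lemma cylprob_ge0 A : 0 <= cylprob A.
Proof. exact: fdprob_ge0. Qed.

Lemma cylprobU A B m n : measurable A -> measurable B -> depends m A -> depends n B ->
  A `&` B = set0 -> cylprob (A `|` B) = cylprob A + cylprob B.
Proof.
move=> mA mB /(depends_leq (leq_maxl m n)) dA /(depends_leq (leq_maxr m n)) dB AB.
by rewrite (cylprobE (dependsU dA dB)) (cylprobE dA) (cylprobE dB) fdprobU.
Qed.

Lemma cylprob0 : cylprob set0 = 0.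
Proof. by rewrite (@cylprobE 0%N) ?fdprob0. Qed.

End finite_dimensional.

(** * The cylinder premeasure and its extension *)

Section cylinders.
Context {d : measure_display} (V : measurableType d).

Definition cylinders : set (set (seq_space V)) :=
  [set A | measurable A /\ exists n, depends n A].

(** A separate alias, since [nat -> V] must carry the algebra of cylinders here and a sigma-algebra
    as [seq_space V]. *)
Definition cyl_space : Type := nat -> V.
HB.instance Definition _ := Pointed.on cyl_space.

Let cylinders0 : cylinders set0.
Proof. by split=> //; exists 0%N. Qed.

Let cylindersU : setU_closed cylinders.
Proof.
move=> A B [mA [m dA]] [mB [n dB]]; split; first exact: measurableU.
exists (maxn m n); apply: dependsU.
  exact: depends_leq (leq_maxl _ _) dA.
exact: depends_leq (leq_maxr _ _) dB.
Qed.

Let cylindersC : setC_closed cylinders.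
Proof.
move=> A [mA [m dA]]; split; first exact: measurableC.
by exists m; exact: dependsC.
Qed.

Definition cyl_display : measure_display. Proof. exact: measurable_structure.default_measure_display. Qed.

HB.instance Definition _ := @isAlgebraOfSets.Build cyl_display cyl_space cylinders
  cylinders0 cylindersU cylindersC.

End cylinders.

Section cylinder_measure.
Context {d : measure_display} (V : measurableType d) (R : realType).
Variable P : probability V R.
Local Open Scope ereal_scope.

Definition cylmeasure : set (cyl_space V) -> \bar R := cylprob P.

(** Reduces to continuity at the empty set. The remainders [D n] of the union decrease; a positive
    limit of their masses would give a sequence in all of them, hence in the union but in no
    [F n]. *)
Let cylmeasure_semi_sigma_additive : semi_sigma_additive cylmeasure.
Proof.
move=> F mF tF mU; set U := \bigcup_n F n.
pose D n := U `\` \big[setU/set0]_(i < n) F i.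
have mD n : measurable (D n).
  by apply: measurableD => //; apply: bigsetU_measurable.
have sub_add n : cylprob P (D n) = cylprob P (F n) + cylprob P (D n.+1).
  have [mFn [k dk]] := mF n; have [mDn [l dl]] := mD n.+1.
  rewrite -(cylprobU _ mFn mDn dk dl).
    congr cylprob; apply/seteqP; split=> w; rewrite /D big_ord_recr /=.
      move=> [Uw nw]; have [Fw|Fw] := pselect (F n w); first by left.
      by right; split=> // -[].
    move=> [Fw|[Uw nw]]; last by split=> // h; apply: nw; left.
    split; first by exists n.
    rewrite -bigcup_mkord => -[i /= iN Fi].
    by have iE : i = n := tF i n I I (ex_intro _ w (conj Fi Fw)); rewrite iE ltnn in iN.
  apply/seteqP; split=> w // -[Fw [_]]; apply.
  by rewrite big_ord_recr /=; right.
have sumE n : \sum_(0 <= i < n) cylprob P (F i) + cylprob P (D n) = cylprob P U.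
  elim: n => [|n IH].
    by rewrite big_geq // add0e /D big_ord0 setD0.
  by rewrite big_nat_recr //= -addeA -sub_add.
have finD n : cylprob P (D n) \is a fin_num.
  have [mDn [l dl]] := mD n; rewrite (cylprobE _ dl) ge0_fin_numE ?fdprob_ge0 //.
  by rewrite (le_lt_trans (fdprob_le1 _ _ mDn)) // ltry.
have Uf : cylprob P U \is a fin_num by rewrite (_ : U = D 0%N) // /D big_ord0 setD0.
have sumE' n : \sum_(0 <= i < n) cylprob P (F i) = cylprob P U - cylprob P (D n).
  by rewrite -(sumE n) addeK.
have ndD : nonincreasing_seq (fun n => cylprob P (D n)).
  by apply/nonincreasing_seqP => n; rewrite (sub_add n) leeDr // cylprob_ge0.
have cvD : cylprob P (D n) @[n --> \oo] --> 0.
  have := ereal_nonincreasing_cvgn ndD; set l := ereal_inf _.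
  suff -> : l = 0 by [].
  apply/eqP; rewrite eq_le; apply/andP; split; last first.
    by apply: le_ereal_inf_tmp => _ [n _ <-]; exact: cylprob_ge0.
  rewrite leNgt; apply/negP => l0.
  have lD n : l <= cylprob P (D n) by apply: ereal_inf_lbound; exists n.
  have lf : l \is a fin_num.
    by rewrite ge0_fin_numE ?ltW //; apply: le_lt_trans (lD 0%N) _; rewrite ltey_eq finD.
  have [w Dw] : exists w, forall n, D n w.
    apply: (@bigcap_cylinders_neq0 _ _ _ P _ (fine l)).
    - by rewrite -lte_fin fineK.
    - by move=> n; have [] := mD n.
    - by move=> n; have [] := mD n.
    - move=> n w [Uw nw]; split=> // h; apply: nw.
      by rewrite big_ord_recr /=; left.
    - by move=> n; rewrite fineK.
  have [[n _ Fnw] _] := Dw 0%N.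
  by have [_] := Dw n.+1; apply; rewrite big_ord_recr /=; right.
rewrite /cylmeasure (_ : (fun n => _) = (fun n => cylprob P U - cylprob P (D n))).
  rewrite -[X in _ --> X]sube0; apply: cvgeB => //; first by rewrite fin_num_adde_defl.
  exact: cvg_cst.
by apply/funext => n; exact: sumE'.
Qed.

HB.instance Definition _ := isMeasure.Build _ (cyl_space V) R cylmeasure
  (cylprob0 P) (cylprob_ge0 P) cylmeasure_semi_sigma_additive.

End cylinder_measure.

(** Caratheodory extension from the cylinders. Independence is exported as the probability of
    rectangles, the form in which the event of rejecting before round [i] and accepting at round [i]
    is evaluated. *)
Lemma iid_sequence (R : realType) d (V : measurableType d) (P : probability V R) :
  exists (dZ : measure_display) (Z : measurableType dZ) (PZ : probability Z R)
    (c : nat -> Z -> V), (forall i, measurable_fun setT (c i)) /\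
    forall N (B : nat -> set V), (forall i, measurable (B i)) ->
      PZ [set z | forall i, (i < N)%N -> B i (c i z)] = (\prod_(i < N) P (B i))%E.
Proof.
pose Z : measurableType _ := g_sigma_algebraType (@measurable _ (cyl_space V)).
pose m : {measure set Z -> \bar R} := measure_extension (cylmeasure P).
have mE A : @measurable _ (cyl_space V) A -> m A = cylprob P A.
  by move=> mA; rewrite /m /= /measure_extension measurable_mu_extE.
have m1 : m setT = 1%E.
  rewrite mE; first by rewrite (@cylprobE _ _ _ _ 0%N) // fdprobT.
  exact: measurableT.
have mcyl_coord i B : measurable B -> @measurable _ (cyl_space V) [set w | B (w i)].
  move=> mB; split; first by rewrite -[X in measurable X]setTI; exact: measurable_coord.
  by exists i.+1 => w w' ww' /=; rewrite ww'.
exists _, Z, [the probability Z R of mprob m1], (fun i (z : Z) => z i); split.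
  move=> i _ B mB; rewrite setTI; apply: sub_sigma_algebra; exact: mcyl_coord.
move=> N B mB; rewrite -(fdprob_rect P _ mB).
have dB : depends N [set w : seq_space V | forall i, (i < N)%N -> B i (w i)].
  by move=> w w' ww' /= h i iN; rewrite -ww' //; exact: h.
rewrite -(cylprobE P dB) -mE //; split; last by exists N.
rewrite (_ : [set w | _] = \bigcap_(i in `I_N) [set w | B i (w i)]) //.
by apply: bigcap_measurableType => i _; case: (mcyl_coord i (B i) (mB i)).
Qed.

(** * Real inequalities *)

Section real_inequalities.
Context {R : realType}.
Implicit Types x y r s t u w g p : R.

Lemma expR_ge_quadratic x : 0 <= x -> 1 + x + x ^+ 2 / 2 <= expR x.
Proof.
move=> x0; have := @nondecreasing_cvgn_le R (series (exp_coeff x)).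
have nd : nondecreasing_seq (series (exp_coeff x)).
  apply/nondecreasing_seqP => n; rewrite /series /= big_nat_recr //= lerDl.
  by rewrite /exp_coeff divr_ge0 // exprn_ge0.
move=> /(_ nd (is_cvg_series_exp_coeff x) 3%N); rewrite /series /=.
rewrite 3?big_nat_recr //= big_geq // add0r /exp_coeff /=.
by rewrite expr0 expr1 !factS fact0 !divr1.
Qed.

(** With [x = ln r] this is [x <= sinh x]. Writing [e] for [expR x], it follows from [(e - x) ^ 2 >=
    (1 + x ^ 2 / 2) ^ 2 >= 1 + x ^ 2]. *)
Lemma ln_le_half_diff r : 1 <= r -> ln r <= (r - r^-1) / 2.
Proof.
move=> r1; have r0 : 0 < r by exact: lt_le_trans r1.
have x0 := ln_ge0 r1; set x := ln r in x0 *.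
have -> : r = expR x by rewrite /x lnK.
have := expR_ge_quadratic x0; set e := expR x => he.
have e0 : 0 < e by exact: expR_gt0.
rewrite ler_pdivlMr // lerBrDr -(ler_pM2r e0) mulrDl mulVf ?gt_eqF //.
nra.
Qed.

Lemma le_lnB1 x : 0 < x -> ln x <= x - 1.
Proof. by move=> x0; rewrite -[X in ln X](subrKC 1) le_ln1Dx // ltrBrDl subrr. Qed.

Lemma ln_ge1BV x : 0 < x -> 1 - x^-1 <= ln x.
Proof.
move=> x0.
have := @le_lnB1 x^-1; rewrite invr_gt0 lnV ?posrE // => /(_ x0).
lra.
Qed.

(* [Psi] is the primitive of the nondecreasing [psi] that vanishes at 0, and
   [psi w - 1] bounds [ln w] from above without the singularity at 0. *)
Definition psi w : R := if w <= 1 then w else 1 + ln w.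

Definition Psi p : R := if p <= 1 then p ^+ 2 / 2 else p * ln p + 2^-1.

Lemma psi_ge0 w : 0 <= w -> 0 <= psi w.
Proof.
rewrite /psi; case: (leP w 1) => // w1 _; rewrite addr_ge0 // ln_ge0 //; exact: ltW.
Qed.

Lemma Psi_ge0 p : 0 <= Psi p.
Proof.
rewrite /Psi; case: (leP p 1) => p1; first by rewrite divr_ge0 // sqr_ge0.
rewrite addr_ge0 ?invr_ge0 // mulr_ge0 //; last exact/ln_ge0/ltW.
by rewrite (le_trans _ (ltW p1)).
Qed.

Lemma ln_add_le_psi t w : 0 < t <= 1 -> 0 <= w -> ln (t + w) + 1 <= t + psi w.
Proof.
move=> /andP[t0 t1] w0; rewrite /psi; case: (leP w 1) => w1.
  have := @le_lnB1 (t + w); rewrite ltr_pwDl // => /(_ isT); lra.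
have w00 : 0 < w by exact: lt_trans w1.
have -> : t + w = w * (1 + t / w) by rewrite mulrDr mulr1 mulrCA divff ?gt_eqF ?mulr1 1?addrC.
have tw : 0 < t / w by rewrite divr_gt0.
rewrite lnM ?posrE //; last by rewrite ltr_wpDl.
have := @le_ln1Dx _ (t / w); rewrite (lt_trans _ tw) ?ltrN10 // => /(_ isT).
have : t / w <= t by rewrite ler_pdivrMr // ler_peMr ?ltW.
lra.
Qed.

(** A rectangle under the graph of the nondecreasing derivative [psi], with its height taken at the
    left end. *)
Lemma psi_le_dPsi a b : 0 <= a <= b -> (b - a) * psi a <= Psi b - Psi a.
Proof.
move=> /andP[a0 ab]; rewrite /psi /Psi; case: (leP a 1) => a1; case: (leP b 1) => b1.
- nra.
- have b0 : 0 < b by exact: lt_trans b1.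
  have := ler_wpM2l (ltW b0) (ln_ge1BV b0).
  rewrite mulrBr mulr1 divff ?gt_eqF //; nra.
- by have := le_lt_trans b1 a1; rewrite ltNge ab.
- have b0 : 0 < b by exact: lt_trans b1.
  have a00 : 0 < a by exact: lt_trans a1.
  have := @ln_ge1BV (b / a); rewrite divr_gt0 // => /(_ isT).
  rewrite ln_div ?posrE // invf_div => /(ler_wpM2l (ltW b0)).
  have -> : b * (1 - a / b) = b - a by field; rewrite gt_eqF.
  nra.
Qed.

(** Convexity of [Psi] together with [Psi 0 = 0]. *)
Lemma Psi_scale t g : 0 <= t <= 1 -> 0 <= g -> Psi (t * g) <= t * Psi g.
Proof.
move=> /andP[t0 t1] g0; rewrite /Psi; case: (leP g 1) => g1.
  rewrite ifT; last by rewrite mulr_ile1.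
  by rewrite exprMn; have : t ^+ 2 <= t; nra.
have lng := ln_gt0 g1.
have g00 : 0 < g by exact: lt_trans g1.
have glng : g - 1 <= g * ln g.
  have := ler_wpM2l g0 (ln_ge1BV g00); rewrite mulrBr mulr1 divff ?gt_eqF //.
case: (leP (t * g) 1) => tg1.
  have : (t * g) * (t * g) <= t * g by rewrite ler_piMl // mulr_ge0.
  rewrite expr2; nra.
have t00 : 0 < t by rewrite lt_neqAle t0 andbT; apply/eqP => t0'; move: tg1; rewrite -t0' mul0r ltr10.
have := le_lnB1 t00.
rewrite lnM ?posrE // mulrDr => h.
have : t * g * ln t <= t * g * (t - 1) by rewrite ler_wpM2l // mulr_ge0.
have : t * g * (t - 1) <= 1 * (t - 1) by apply: ler_wnM2r; rewrite ?subr_le0 // ltW.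
nra.
Qed.

(** For [0 < g <= 1] the inequality [g ^ 2 / 2 <= g * ln g + 1/2] is [x <= sinh x] at [x = - ln g];
    for [g > 1] it is the definition of [Psi]. Truncation at [e] only raises the logarithm. *)
Lemma Psi_le_ln e g : 0 < e <= 1 -> 0 <= g -> Psi g <= g * ln (Num.max g e) + 2^-1.
Proof.
move=> /andP[e0 e1]; rewrite le_eqVlt => /predU1P[<-|g0].
  by rewrite /Psi ler01 expr0n /= mul0r mul0r add0r invr_ge0.
have : ln g <= ln (Num.max g e) by rewrite ler_ln ?posrE // ?lt_max ?g0 // le_max lexx.
move=> /(ler_wpM2l (ltW g0)).
rewrite /Psi; case: (leP g 1) => g1; last lra.
have := @ln_le_half_diff g^-1; rewrite -invr1 lef_pV2 ?posrE // => /(_ g1).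
rewrite invrK lnV ?posrE // invr1 => /(ler_wpM2l (ltW g0)).
have -> : g * ((g^-1 - g) / 2) = (1 - g ^+ 2) / 2 by field; rewrite gt_eqF.
nra.
Qed.

(** [s ^ 2 / 2 + s - s * ln s] is a primitive of [s - ln s], which decreases on []0, 1]]; the
    left-hand side is the rectangle of smallest height. *)
Lemma ln_telescope s s' : 0 <= s' <= s -> s <= 1 ->
  (s - s') * (s - ln s) <=
  (s ^+ 2 / 2 + s - s * ln s) - (s' ^+ 2 / 2 + s' - s' * ln s').
Proof.
move=> /andP[+ ss'] s1; rewrite le_eqVlt => /predU1P[s'0|s'0].
  rewrite -s'0 expr0n /= in ss' *; nra.
have s0 : 0 < s by exact: lt_le_trans ss'.
have := @ln_le_half_diff (s / s'); rewrite ler_pdivlMr // mul1r => /(_ ss').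
rewrite ln_div ?posrE // invf_div => /(ler_wpM2l (ltW s'0)) h.
have : s' * ((s / s' - s' / s) / 2) <= (s - s') - (s - s') ^+ 2 / 2.
  rewrite -(ler_pM2r s0).
  have -> : s' * ((s / s' - s' / s) / 2) * s = (s ^+ 2 - s' ^+ 2) / 2.
    by field; rewrite !gt_eqF.
  rewrite -subr_ge0.
  have -> : (s - s' - (s - s') ^+ 2 / 2) * s - (s ^+ 2 - s' ^+ 2) / 2 =
    (s - s') ^+ 2 / 2 * (1 - s) by field.
  by rewrite mulr_ge0 ?subr_ge0 // divr_ge0 // sqr_ge0.
nra.
Qed.

Lemma telescope_potential_ge0 s : 0 <= s <= 1 -> 0 <= s ^+ 2 / 2 + s - s * ln s.
Proof.
move=> /andP[s0 s1]; have := ln_le0 s1; nra.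
Qed.

(** The hypothesis gives [s * (1 + i / n) <= s + S / n]. Taking logarithms separates a term in [s]
    alone, which will telescope over the rounds, from a term in the filled level [S]. *)
Lemma ln_index_le (i n : nat) s S : (0 < n)%N -> 0 < s <= 1 -> i%:R * s <= S ->
  ln (1 + i%:R / n%:R) + 1 <= (s - ln s) + psi (S / n%:R).
Proof.
move=> n0 /andP[s0 s1] iS; have n0' : 0 < n%:R :> R by rewrite ltr0n.
have S0 : 0 <= S / n%:R.
  by rewrite divr_ge0 ?(ltW n0') // (le_trans _ iS) // mulr_ge0 // ltW.
have i1 : 0 < 1 + i%:R / n%:R :> R by rewrite ltr_pwDl // divr_ge0 // ltW.
have := @ln_add_le_psi s (S / n%:R); rewrite s0 s1 => /(_ isT S0).
suff : ln (s * (1 + i%:R / n%:R)) <= ln (s + S / n%:R).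
  by rewrite lnM ?posrE //; lra.
rewrite ler_ln ?posrE ?mulr_gt0 //; last by rewrite ltr_pwDl.
rewrite mulrDr mulr1 lerD2l mulrA ler_pM2r ?invr_gt0 //.
by rewrite mulrC.
Qed.

(* The total mass is at most 1 by comparison with the integral of
   [(1 + t / n) ^ (- (1 + 1 / L))] over the half-line, which is [n * L]. *)
Definition index_weight L (n i : nat) : R :=
  expR (- ((1 + L^-1) * ln (1 + i%:R / n%:R))) / (n%:R * (1 + L)).

Lemma index_weight_gt0 L n i : 0 < L -> (0 < n)%N -> 0 < index_weight L n i.
Proof.
move=> L0 n0; rewrite divr_gt0 ?expR_gt0 // mulr_gt0 ?ltr0n //; lra.
Qed.

Lemma sum_index_weight_le1 L n N : 0 < L -> (0 < n)%N ->
  \sum_(i < N) index_weight L n i <= 1.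
Proof.
move=> L0 n0; rewrite -mulr_suml.
have n0' : 0 < n%:R :> R by rewrite ltr0n.
have n1 : 1 <= n%:R :> R by rewrite ler1n.
have L1 : 0 < 1 + L by lra.
rewrite ler_pdivrMr ?mulr_gt0 // mul1r.
pose x (i : nat) : R := 1 + i%:R / n%:R.
have x1 i : 1 <= x i by rewrite lerDl divr_ge0 // ltW.
have x0 i : 0 < x i by exact: lt_le_trans (x1 i).
pose a : R := L^-1; have a0 : 0 < a by rewrite invr_gt0.
(* The term is compared with the integral of [t ^ (- (1 + a))] over [[x i, x i.+1]], an interval of
   length [1 / n]; the right-hand side is [n] times that integral. *)
have step i : expR (- ((1 + a) * ln (x i.+1))) <=
    n%:R * L * (expR (- (a * ln (x i))) - expR (- (a * ln (x i.+1)))).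
  rewrite mulrDl mul1r opprD expRD (expRN (ln (x i.+1))) lnK ?posrE // mulrC.
  have -> : expR (- (a * ln (x i))) =
      expR (- (a * ln (x i.+1))) * expR (a * (ln (x i.+1) - ln (x i))).
    by rewrite -expRD; congr expR; ring.
  set E := expR (- (a * ln (x i.+1))); have E0 : 0 < E by exact: expR_gt0.
  rewrite -[X in _ * (_ - X)]mulr1 -mulrBr mulrCA ler_pM2l //.
  have h1 : 1 + a * (ln (x i.+1) - ln (x i)) <= expR (a * (ln (x i.+1) - ln (x i))).
    exact: expR_ge1Dx.
  have h2 : (n%:R * x i.+1)^-1 <= ln (x i.+1) - ln (x i).
    have := @ln_ge1BV (x i.+1 / x i); rewrite divr_gt0 // => /(_ isT).
    rewrite ln_div ?posrE // invf_div; apply: le_trans.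
    rewrite (_ : 1 - _ = (n%:R * x i.+1)^-1) // /x.
    have xn : n%:R + i.+1%:R != 0 :> R by rewrite gt_eqF // ltr_pwDl.
    by rewrite -natr1 in xn *; field; rewrite gt_eqF //= -addrA xn.
  have : a * (n%:R * x i.+1)^-1 <= expR (a * (ln (x i.+1) - ln (x i))) - 1.
    by have := ler_wpM2l (ltW a0) h2; lra.
  move=> /(ler_wpM2l (ltW (mulr_gt0 n0' L0))); apply: le_trans.
  rewrite /a (_ : n%:R * L * _ = (x i.+1)^-1) //.
  by field; rewrite !gt_eqF.
have -> : n%:R * (1 + L) = n%:R + n%:R * L by rewrite mulrDr mulr1.
(* The term of index 0 equals 1 and stays outside the telescoping sum; it is absorbed by the [n] in
   [n + n * L]. *)
suff h : \sum_(i < N.+1) expR (- ((1 + L^-1) * ln (1 + i%:R / n%:R)))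
    <= 1 + n%:R * L * (1 - expR (- (a * ln (x N)))).
  have h' := le_trans h _; apply: le_trans (h' (n%:R + n%:R * L) _).
    by rewrite big_ord_recr /= lerDl expR_ge0.
  apply: lerD => //.
  by rewrite ler_piMr ?mulr_ge0 ?(ltW L0) // gerBl expR_ge0.
elim: N => [|N IH].
  by rewrite big_ord_recl big_ord0 /x /= mul0r !addr0 ln1 !mulr0 oppr0 expR0 subrr mulr0 addr0.
rewrite big_ord_recr /=; apply: le_trans (lerD IH (step N)) _.
by rewrite -addrA -mulrDr addrA subrK.
Qed.

Lemma ln2_ge : 2 / 3 <= ln 2 :> R.
Proof.
(* The goal amounts to [expR 2 <= 8]. Cutting the exponent 2 into 32 steps of 1/16 is fine enough,
   since [(16/15) ^ 32 <= 8]. *)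
have h : expR (16^-1) <= 16 / 15 :> R.
  have := @expR_ge1Dx R (- 16^-1); rewrite expRN.
  have e0 := expR_gt0 (16^-1 : R).
  by move=> /(ler_wpM2l (ltW e0)); rewrite mulfV ?gt_eqF //; lra.
rewrite -ler_expR lnK ?posrE //.
have -> : 2 / 3 = 3^-1 * 2 :> R by ring.
rewrite -(@ler_pXn2r _ 3) ?nnegrE ?expR_ge0 // -expRM_natr mulrAC mulVf // mul1r.
have -> : 2 = 16^-1 * 32%:R :> R by field.
rewrite expRM_natr; apply: (@le_trans _ _ ((16 / 15) ^+ 32)).
  by rewrite lerXn2r ?nnegrE ?expR_ge0.
lra.
Qed.

Lemma log2M x y : 0 < x -> 0 < y -> log2 (x * y) = log2 x + log2 y.
Proof. by move=> x0 y0; rewrite /log2 lnM ?posrE // mulrDl. Qed.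

Lemma ln2_gt0 : 0 < ln 2 :> R.
Proof. by rewrite ln_gt0 // ltr1n. Qed.

Lemma le_log2 x y : 0 < x -> x <= y -> log2 x <= log2 y.
Proof.
move=> x0 xy; rewrite /log2 ler_pM2r ?invr_gt0 ?ln2_gt0 // ler_ln ?posrE //.
exact: lt_le_trans xy.
Qed.

(** Amounts to [(13/5) ^ 5 <= 2 ^ 7]. *)
Lemma log2_13_5 : log2 (13 / 5) <= 7 / 5 :> R.
Proof.
rewrite /log2 ler_pdivrMr ?ln2_gt0 // -(@ler_pM2r _ 5%:R) //.
have -> : 7 / 5 * ln 2 * 5%:R = ln 2 *+ 7 :> R by rewrite -mulr_natr; field.
rewrite mulr_natr -!lnXn ?divr_gt0 // ler_ln ?posrE ?exprn_gt0 ?divr_gt0 //.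
lra.
Qed.

(** The constant 4 is 8/5 from [L], plus 1 from [L^-1 * L], plus 7/5 from
    [1 + L <= (I + 1) * (13/5)]. *)
Lemma total_cost_le (I : R) (n : nat) : 0 <= I -> (0 < n)%N ->
  let L := I + 8 / 5 in
  log2 (n%:R * (1 + L)) + (1 + L^-1) * L <= I + log2 (n%:R * (I + 1)) + 4.
Proof.
move=> I0 n0 /=; have n0' : 0 < n%:R :> R by rewrite ltr0n.
set L := I + 8 / 5; have L0 : 0 < L by rewrite /L; lra.
rewrite mulrDl mul1r mulVf ?gt_eqF // !log2M //; try lra.
have : log2 (1 + L) <= log2 ((I + 1) * (13 / 5)) by apply: le_log2; rewrite /L; lra.
rewrite log2M ?divr_gt0 //; last lra.
have := log2_13_5; rewrite /L; lra.
Qed.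

(** Conversion from nats to bits: [ln 2 >= 2/3] gives [(17/16) / ln 2 <= 51/32], just below 8/5. *)
Lemma bits_le (I : R) : (1 + 16^-1 + I * ln 2) / ln 2 <= I + 8 / 5.
Proof.
rewrite ler_pdivrMr ?ln2_gt0 // mulrDl addrC lerD2l.
have := ln2_ge; lra.
Qed.

End real_inequalities.

(** * Greedy rejection sampling for a fixed density *)

Section uniform_threshold.
Context {R : realType}.
Local Open Scope ereal_scope.

Definition unif : probability (measurableTypeR R) R := uniform_prob (@ltr01 R).

Lemma unif_itv (A : set R) : measurable A -> unif A = lebesgue_measure (A `&` `[0%R, 1%R]).
Proof.
move=> mA; rewrite /unif /= /uniform_prob integral_uniform_pdf.
rewrite (eq_integral (cst 1)).
  by rewrite integral_cst ?mul1e //; exact: measurableI.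
by move=> v; rewrite inE => -[_] /=; rewrite in_itv /= /uniform_pdf => ->; rewrite subr0 invr1.
Qed.

(** The factor [s] replaces a division in the statement, so that a round reached with probability 0
    is covered too. *)
Lemma unif_threshold (s S c : R) : (0 <= s)%R ->
  s%:E * unif [set v | S + s * v < c]%R = (Num.min s (Num.max 0 (c - S)))%:E.
Proof.
rewrite le_eqVlt => /predU1P[<-|s0].
  by rewrite mul0e min_l // le_max lexx.
pose t : R := ((c - S) / s)%R.
have -> : [set v : R | S + s * v < c]%R = `]-oo, t[%classic.
  apply/seteqP; split => v /=; rewrite in_itv /= /t ltr_pdivlMr // mulrC ltrBrDl //.
rewrite unif_itv //.
have -> : (Num.min s (Num.max 0 (c - S)))%R = (s * Num.min 1 (Num.max 0 t))%R.
  rewrite minr_pMr ?(ltW s0) // mulr1 maxr_pMr ?(ltW s0) // mulr0 /t.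
  by rewrite mulrCA divff ?mulr1 // gt_eqF.
rewrite EFinM; congr (_ * _).
have [t0|t0] := leP t 0%R.
  rewrite min_r // (_ : _ `&` _ = set0) ?measure0 //.
  apply/seteqP; split => v //= [] /=; rewrite !in_itv /= => vt /andP[v0 _].
  by have := lt_le_trans vt t0; rewrite ltNge v0.
have [t1|t1] := leP t 1%R.
  rewrite (_ : _ `&` _ = `[0%R, t[%classic).
    by rewrite lebesgue_measure_itv /= lte_fin t0 oppr0 adde0.
  apply/seteqP; split => v /=; rewrite !in_itv /=.
    by move=> [vt /andP[-> _]].
  by move=> /andP[-> vt]; split=> //; rewrite ltW // (lt_le_trans vt).
rewrite (_ : _ `&` _ = `[0%R, 1%R]%classic).
  by rewrite lebesgue_measure_itv /= lte_fin ltr01 oppr0 adde0.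
apply/seteqP; split => v /=; rewrite !in_itv /=; first by move=> [].
by move=> /andP[-> v1]; split=> //; exact: le_lt_trans t1.
Qed.

End uniform_threshold.

Section greedy.
Context {R : realType} {d : measure_display} {Y : measurableType d}.
Variable rho : probability Y R.
Implicit Types (f : Y -> R) (s S : R) (B : set Y).
Local Open Scope ereal_scope.

Definition marked : probability (Y * measurableTypeR R)%type R := rho \x (@unif R).

Local Notation P := marked.

Definition accept f s S : set (Y * R) := [set p | S + s * p.2 < f p.1]%R.

(* The pair [(s, S)] holds the probability [s] that no round before [i] accepts and
   the sum [S] of these probabilities over the earlier rounds.  Round [i] accepts [y]
   with probability [min (s, (f y - S)^+) / s], so that the accepted densities fill
   the region under [f] layer by layer. *)
Fixpoint levels f (i : nat) : R * R :=
  if i is j.+1 then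
    let s := (levels f j).1 in let S := (levels f j).2 in
    (s * (1 - fine (P (accept f s S))), S + s)%R
  else (1, 0)%R.

Definition survival f i := (levels f i).1.
Definition level f i := (levels f i).2.
Definition accept_at f i := accept f (survival f i) (level f i).
Definition pick_prob f i := (survival f i * fine (P (accept_at f i)))%R.
Definition increment f i y := (Num.min (survival f i) (Num.max 0 (f y - level f i)))%R.

Lemma survivalS f i : survival f i.+1 = (survival f i - pick_prob f i)%R.
Proof. by rewrite /survival /= mulrBr mulr1. Qed.

Lemma levelS f i : level f i.+1 = (level f i + survival f i)%R.
Proof. by []. Qed.

Lemma accept_measurable f s S : measurable_fun setT f -> measurable (accept f s S).
Proof.
move=> mf; rewrite -[X in measurable X]setTI.
have : measurable_fun setT (fun p : Y * R => (S + s * p.2 < f p.1)%R).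
  apply: measurable_fun_ltr; last exact: (measurableT_comp mf measurable_fst).
  apply: measurable_funD => //; apply: measurable_funM => //; exact: measurable_snd.
by move=> /(_ measurableT [set true]); apply.
Qed.

Lemma acceptX_measurable f s S B : measurable_fun setT f -> measurable B ->
  measurable (accept f s S `&` B `*` setT).
Proof.
move=> mf mB; apply: measurableI; first exact: accept_measurable.
exact: measurableX.
Qed.

Lemma survival_bounds f i : measurable_fun setT f -> (0 <= survival f i <= 1)%R.
Proof.
move=> mf; elim: i => [|i /andP[s0 s1]]; first by rewrite /survival /= ler01 lexx.
have mA := accept_measurable (survival f i) (level f i) mf.
have p1 : (fine (P (accept_at f i)) <= 1)%R.
  by rewrite -lee_fin fineK ?probability_le1 // fin_num_measure.
have p0 : (0 <= fine (P (accept_at f i)))%R by rewrite fine_ge0.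
rewrite survivalS /pick_prob; nra.
Qed.

Lemma pick_prob_ge0 f i : measurable_fun setT f -> (0 <= pick_prob f i)%R.
Proof.
by move=> /(survival_bounds i)/andP[s0 _]; rewrite mulr_ge0 // fine_ge0.
Qed.

Lemma survival_le f i : measurable_fun setT f -> (survival f i.+1 <= survival f i)%R.
Proof. by move=> mf; rewrite survivalS gerBl pick_prob_ge0. Qed.

(** The level is a sum of [i] earlier survival probabilities, each at least the current one. This is
    how an index gets bounded by a filled mass. *)
Lemma index_survival_le_level f i : measurable_fun setT f ->
  (i%:R * survival f i <= level f i)%R.
Proof.
move=> mf; elim: i => [|i IH]; first by rewrite mul0r.
rewrite levelS -natr1 mulrDl mul1r lerD ?survival_le //.
by rewrite (le_trans _ IH) // ler_wpM2l // survival_le.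
Qed.

Lemma level_ge0 f i : measurable_fun setT f -> (0 <= level f i)%R.
Proof.
move=> mf; elim: i => // i IH; rewrite levelS addr_ge0 //.
by have /andP[] := survival_bounds i mf.
Qed.

Lemma increment_ge0 f i y : measurable_fun setT f -> (0 <= increment f i y)%R.
Proof.
move=> /(survival_bounds i)/andP[s0 _].
by rewrite /increment le_min s0 le_max lexx.
Qed.

Lemma measurable_increment f i : measurable_fun setT f ->
  measurable_fun setT (increment f i).
Proof.
move=> mf; apply: measurable_minr => //; apply: measurable_maxr => //.
exact: measurable_funB.
Qed.

(** Integrating out the mark first, [unif_threshold] shows that reaching round [i] and accepting
    there has density [increment f i] with respect to [rho]. *)
Lemma survival_accept f i B : measurable_fun setT f -> measurable B ->
  (survival f i)%:E * P (accept_at f i `&` B `*` setT) =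
  \int[rho]_(y in B) (increment f i y)%:E.
Proof.
move=> mf mB; have /andP[s0 _] := survival_bounds i mf.
have mA := acceptX_measurable (survival f i) (level f i) mf mB.
rewrite /marked /= /product_measure1 -ge0_integralZl //; last exact: measurable_fun_xsection.
rewrite [RHS]integral_mkcond; apply: eq_integral => y _ /=.
rewrite patchE; case: (boolP (y \in B)) => yB.
  rewrite -unif_threshold //; congr (_ * unif _).
  apply/seteqP; split=> v; rewrite xsectionE /accept_at /accept /=; first by move=> [].
  by move=> h; split=> //; split=> //; rewrite inE in yB.
rewrite (_ : xsection _ _ = set0) ?measure0 ?mule0 //.
apply/seteqP; split=> v //; rewrite xsectionE /= => -[_ [/= yB' _]].
by rewrite notin_setE in yB.
Qed.

Lemma integral_increment f i : measurable_fun setT f ->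
  \int[rho]_y (increment f i y)%:E = (pick_prob f i)%:E.
Proof.
move=> mf; rewrite -survival_accept // setXTT setIT /pick_prob EFinM fineK //.
by rewrite fin_num_measure //; exact: accept_measurable.
Qed.

Lemma sum_increment f N y : measurable_fun setT f -> (0 <= f y)%R ->
  (\sum_(i < N) increment f i y = Num.min (f y) (level f N))%R.
Proof.
move=> mf f0; elim: N => [|N IH]; first by rewrite big_ord0 min_r.
rewrite big_ord_recr /= IH levelS /increment.
have /andP[s0 _] := survival_bounds N mf.
have [h1|h1] := leP (f y) (level f N).
  by rewrite max_l ?subr_le0 // min_r // addr0 min_l // (le_trans h1) // lerDl.
rewrite max_r ?subr_ge0 ?ltW //.
have [h2|h2] := leP (survival f N) (f y - level f N)%R.
  by rewrite min_r //; lra.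
by rewrite min_l; lra.
Qed.

Section density.
Variable f : Y -> R.
Hypothesis mf : measurable_fun setT f.
Hypothesis f0 : forall y, (0 <= f y)%R.
Hypothesis f1 : \int[rho]_y (f y)%:E = 1.

Lemma integral_sum_increment N B : measurable B ->
  \sum_(i < N) \int[rho]_(y in B) (increment f i y)%:E =
  \int[rho]_(y in B) (Num.min (f y) (level f N))%:E.
Proof.
move=> mB; rewrite -ge0_integral_sum //.
- by apply: eq_integral => y _; rewrite sumEFin sum_increment.
- by move=> i; apply/measurable_EFinP/measurable_funTS/measurable_increment.
- by move=> i y _; rewrite lee_fin increment_ge0.
Qed.

Lemma sum_pick_prob N : (\sum_(i < N) pick_prob f i = 1 - survival f N)%R.
Proof.
elim: N => [|N IH]; first by rewrite big_ord0 subrr.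
by rewrite big_ord_recr /= IH survivalS opprB addrA addrAC.
Qed.

Lemma integral_truncated_density N :
  \int[rho]_y (Num.min (f y) (level f N))%:E = (1 - survival f N)%:E.
Proof.
rewrite -sum_pick_prob -sumEFin -integral_sum_increment //.
by apply: eq_bigr => i _; exact: integral_increment.
Qed.

(** If the limit [l] were positive, the levels would grow at least like [n * l], so the truncations
    of [f] would converge to [f] and their integrals to 1; yet these integrals stay below
    [1 - l]. *)
Lemma survival_cvg0 : survival f i @[i --> \oo] --> (0 : R)%R.
Proof.
have nd : nonincreasing_seq (survival f).
  by apply/nonincreasing_seqP => n; exact: survival_le.
have lb n : (0 <= survival f n)%R by have /andP[] := survival_bounds n mf.
have hlb : has_lbound (range (survival f)) by exists 0%R => _ [n _ <-].
have cv := nonincreasing_cvgn nd hlb; set l := inf _ in cv.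
have lle n : (l <= survival f n)%R by apply: ge_inf => //; exists n.
suff l0 : l = 0%R by rewrite l0 in cv.
apply/eqP; rewrite eq_le; apply/andP; split; last first.
  by apply: lb_le_inf; [exists (survival f 0), 0%N|move=> _ [n _ <-]].
rewrite leNgt; apply/negP => l0.
have Sl n : (n%:R * l <= level f n)%R.
  by apply: le_trans (index_survival_le_level n mf); rewrite ler_wpM2l.
have le1l n : \int[rho]_y (Num.min (f y) (n%:R * l))%:E <= (1 - l)%:E.
  apply: (@le_trans _ _ (1 - survival f n)%:E); last by rewrite lee_fin lerB.
  rewrite -integral_truncated_density; apply: ge0_le_integral => //.
  - by move=> y _; rewrite lee_fin le_min f0 mulr_ge0 // ltW.
  - by apply/measurable_EFinP; apply: measurable_minr.
  - by apply/measurable_EFinP; apply: measurable_minr.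
  - by move=> y _; rewrite lee_fin le_min !ge_min lexx Sl orbT.
have cvf : \int[rho]_y (Num.min (f y) (n%:R * l))%:E @[n --> \oo] --> \int[rho]_y (f y)%:E.
  have := @cvg_monotone_convergence _ _ _ rho setT measurableT
    (fun n y => (Num.min (f y) (n%:R * l))%:E).
  rewrite (_ : (fun x => limn _) = (fun y => (f y)%:E)).
    apply.
    - by move=> n; apply/measurable_EFinP; apply: measurable_minr.
    - by move=> n y _; rewrite lee_fin le_min f0 mulr_ge0 // ltW.
    - move=> y _ m n mn; rewrite lee_fin le_min !ge_min lexx /=.
      by rewrite ler_wpM2r ?orbT ?ler_nat // ltW.
  apply/funext => y; apply: lim_near_cst => //.
  have [N fN] : exists N : nat, (f y / l <= N%:R)%R.
    exists (Num.truncn (f y / l)).+1.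
    by rewrite ltW // truncnS_gt.
  exists N => // n /= Nn; congr EFin; apply: min_l.
  by rewrite -ler_pdivrMr // (le_trans fN) // ler_nat.
have : 1 <= (1 - l)%:E.
  rewrite -f1 -(cvg_lim _ cvf) //; apply: lime_le; last exact: nearW.
  by apply/cvg_ex; eexists; exact: cvf.
by rewrite lee_fin lerBrDl gerDr leNgt l0.
Qed.

Lemma sum_accept_law B : measurable B ->
  \sum_(i <oo) (survival f i)%:E * P (accept_at f i `&` B `*` setT) =
  \int[rho]_(y in B) (f y)%:E.
Proof.
move=> mB.
have mint g : measurable_fun setT g -> measurable_fun B (EFin \o g).
  by move=> mg; apply/measurable_EFinP; exact: measurable_funTS.
have mmin N : measurable_fun setT (fun y => Num.min (f y) (level f N)).
  exact: measurable_minr.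
have level0 N := level_ge0 N mf.
apply: cvg_lim => //.
rewrite (_ : (fun n => _) = (fun N => \int[rho]_(y in B) (Num.min (f y) (level f N))%:E)); last first.
  apply/funext => N; rewrite big_mkord -integral_sum_increment //.
  by apply: eq_bigr => i _; rewrite survival_accept.
have fBle : \int[rho]_(y in B) (f y)%:E <= 1.
  rewrite -f1; apply: ge0_subset_integral => //; first exact/measurable_EFinP.
  by move=> y _; rewrite lee_fin.
have fB0 : 0 <= \int[rho]_(y in B) (f y)%:E.
  by apply: integral_ge0 => y _; rewrite lee_fin.
(* The mass still missing on [B] is at most the mass missing on the whole space, which is the
   survival probability. *)
have split N : \int[rho]_(y in B) (f y)%:E <=
    \int[rho]_(y in B) (Num.min (f y) (level f N))%:E + (survival f N)%:E.
  have m1 : measurable_fun setT (fun y => f y - Num.min (f y) (level f N))%R.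
    exact: measurable_funB.
  have p1 y : (0 <= f y - Num.min (f y) (level f N))%R.
    by rewrite subr_ge0 ge_min lexx.
  have p2 y : (0 <= Num.min (f y) (level f N))%R by rewrite le_min f0 level0.
  have splitD D : measurable D -> \int[rho]_(y in D) (f y)%:E =
      \int[rho]_(y in D) (Num.min (f y) (level f N))%:E +
      \int[rho]_(y in D) (f y - Num.min (f y) (level f N))%:E.
    move=> mD; rewrite -ge0_integralD //.
    - by apply: eq_integral => y _; rewrite -EFinD addrC subrK.
    - by move=> y _; rewrite lee_fin.
    - by apply/measurable_EFinP; exact: measurable_funTS.
    - by move=> y _; rewrite lee_fin.
    - by apply/measurable_EFinP; exact: measurable_funTS.
  rewrite splitD // leeD2l //.
  apply: (@le_trans _ _ (\int[rho]_y (f y - Num.min (f y) (level f N))%:E)).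
    apply: ge0_subset_integral => //; first exact/measurable_EFinP.
    by move=> y _; rewrite lee_fin.
  have := splitD _ measurableT; rewrite f1 integral_truncated_density.
  set J := \int[rho]_y _; have J0 : 0 <= J.
    by apply: integral_ge0 => y _; rewrite lee_fin.
  case: J J0 => [j| |] //= j0.
  by rewrite -EFinD => -[] h; rewrite lee_fin; lra.
apply: (@squeeze_cvge _ _ _ _ (fun N => \int[rho]_(y in B) (f y)%:E - (survival f N)%:E) _
  (cst (\int[rho]_(y in B) (f y)%:E))).
- apply: nearW => N; apply/andP; split; first by rewrite leeBlDr.
  apply: ge0_le_integral => //.
  + by move=> y _; rewrite lee_fin le_min f0 level0.
  + exact: mint.
  + exact: mint.
  + by move=> y _; rewrite lee_fin ge_min lexx.
- rewrite -[X in _ --> X]sube0; apply: cvgeB.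
  + by rewrite fin_num_adde_defl.
  + exact: cvg_cst.
  + by apply/fine_cvgP; split; [exact: nearW|exact: survival_cvg0].
- exact: cvg_cst.
Qed.

Lemma sum_pick_prob_eq1 : \sum_(i <oo) (pick_prob f i)%:E = 1.
Proof.
rewrite -f1 -sum_accept_law //; apply: eq_eseriesr => i _.
by rewrite survival_accept // integral_increment.
Qed.

Lemma le_Psi (p q : R) : (0 <= p <= q)%R -> (Psi p <= Psi q)%R.
Proof.
move=> /andP[p0 pq]; have := @psi_le_dPsi _ p q; rewrite p0 pq => /(_ isT).
have : (0 <= (q - p) * psi p)%R by rewrite mulr_ge0 ?subr_ge0 // psi_ge0.
lra.
Qed.

(* The left-hand side is a lower Riemann sum of [psi (_ / n)], the nondecreasing
   derivative of [n * Psi (_ / n)]. *)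
Lemma sum_increment_psi (n N : nat) y : (0 < n)%N ->
  (\sum_(i < N) increment f i y * psi (level f i / n%:R) <=
   n%:R * Psi (f y / n%:R))%R.
Proof.
move=> n0; have n0' : (0 < n%:R :> R)%R by rewrite ltr0n.
have lv0 i := level_ge0 i mf.
have mn0 N' : (0 <= Num.min (f y) (level f N') / n%:R)%R.
  by rewrite divr_ge0 ?(ltW n0') // le_min f0 lv0.
(* The induction carries the sharper bound at [f y] truncated to the current level, whose growth
   from one round to the next is exactly the increment. *)
apply: (@le_trans _ _ (n%:R * Psi (Num.min (f y) (level f N) / n%:R))%R); last first.
  by rewrite ler_wpM2l ?(ltW n0') // le_Psi // mn0 ler_pM2r ?invr_gt0 // ge_min lexx.
elim: N => [|N IH]; first by rewrite big_ord0 mulr_ge0 ?Psi_ge0 // ltW.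
rewrite big_ord_recr /=; apply: le_trans (lerD IH (lexx _)) _.
rewrite -lerBrDl -mulrBr.
have incE : (increment f N y = Num.min (f y) (level f N.+1) - Num.min (f y) (level f N))%R.
  by rewrite -!sum_increment // [in RHS]big_ord_recr /= addrAC subrr add0r.
have [h|h] := leP (f y) (level f N).
  have s0 : (level f N <= level f N.+1)%R.
    by rewrite levelS lerDl; have /andP[] := survival_bounds N mf.
  rewrite incE (min_l h) (min_l (le_trans h s0)) subrr mul0r.
  by rewrite subrr mulr0.
have mE : Num.min (f y) (level f N) = level f N by rewrite min_r // ltW.
have inc0 := increment_ge0 N y mf.
have := @psi_le_dPsi R (level f N / n%:R)%R (Num.min (f y) (level f N.+1) / n%:R)%R.
rewrite divr_ge0 ?(ltW n0') //= ler_pM2r ?invr_gt0 //.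
rewrite -subr_ge0 -{1}mE -incE inc0 => /(_ isT).
rewrite -mulrBl -{1}mE -incE => /(ler_wpM2l (ltW n0')); apply: le_trans.
by rewrite mulrA (mulrC n%:R) mulrVK // unitfE gt_eqF.
Qed.

Lemma measurable_Psi : measurable_fun setT (@Psi R).
Proof.
apply: measurable_fun_ifT => /=; first exact: measurable_fun_ler.
  by apply: measurable_funM => //; exact: measurable_funX.
by apply: measurable_funD => //; apply: measurable_funM => //; exact: measurable_ln.
Qed.

Lemma sum_index_cost_partial (n N : nat) : (0 < n)%N ->
  \sum_(i < N) (pick_prob f i * (ln (1 + i%:R / n%:R) + 1))%:E <=
  (3 / 2)%:E + \int[rho]_y (n%:R * Psi (f y / n%:R))%:E.
Proof.
move=> n0; have n0' : (0 < n%:R :> R)%R by rewrite ltr0n.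
(* The primitive of [s - ln s] from [ln_telescope]; its value 3/2 at the initial survival
   probability 1 is the constant of the statement. *)
pose V s : R := (s ^+ 2 / 2 + s - s * ln s)%R.
have lv0 i := level_ge0 i mf.
have ps0 i : (0 <= psi (level f i / n%:R))%R.
  by rewrite psi_ge0 // divr_ge0 // ltW.
have step i : (pick_prob f i * (ln (1 + i%:R / n%:R) + 1) <=
    (V (survival f i) - V (survival f i.+1)) + pick_prob f i * psi (level f i / n%:R))%R.
  have /andP[s0 s1] := survival_bounds i mf.
  have := @ln_telescope R (survival f i) (survival f i.+1).
  have /andP[-> _] := survival_bounds i.+1 mf; rewrite survival_le // => /(_ isT s1).
  have -> : (survival f i - survival f i.+1 = pick_prob f i)%R.
    by rewrite survivalS opprB addrC subrK.
  move=> h; move: s0; rewrite le_eqVlt => /predU1P[s0|s0].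
    have p0 : pick_prob f i = 0%R by rewrite /pick_prob -s0 mul0r.
    by rewrite p0 !mul0r addr0 in h *.
  have := @ln_index_le R i n (survival f i) (level f i) n0.
  rewrite s0 s1 => /(_ isT (index_survival_le_level i mf)).
  move=> /(ler_wpM2l (pick_prob_ge0 i mf)); rewrite mulrDr; move: h; rewrite /V; lra.
apply: (@le_trans _ _ (\sum_(i < N) ((V (survival f i) - V (survival f i.+1))%:E +
    (pick_prob f i * psi (level f i / n%:R))%:E))).
  by apply: lee_sum => i _; rewrite -EFinD lee_fin step.
rewrite big_split /= leeD //.
  rewrite sumEFin lee_fin.
  have -> : (\sum_(i < N) (V (survival f i) - V (survival f i.+1)) =
      V (survival f 0) - V (survival f N))%R.
    elim: N => [|N IH]; first by rewrite big_ord0 subrr.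
    by rewrite big_ord_recr /= IH addrA subrK.
  have := telescope_potential_ge0 (survival_bounds N mf); rewrite -/(V _).
  have -> : V (survival f 0) = (3 / 2)%R.
    by rewrite /V /survival /= ln1 mulr0 expr1n; lra.
  lra.
have minc i : measurable_fun setT (fun y => increment f i y * psi (level f i / n%:R))%R.
  by apply: measurable_funM => //; exact: measurable_increment.
have mPsi : measurable_fun setT (fun y => n%:R * Psi (f y / n%:R))%R.
  apply: measurable_funM => //; apply: (measurableT_comp measurable_Psi).
  exact: measurable_funM.
have inc0 i y : (0 <= increment f i y * psi (level f i / n%:R))%R.
  by rewrite mulr_ge0 // increment_ge0.
rewrite (_ : (\sum_(i < N) _)%R =
  \int[rho]_y \sum_(i < N) (increment f i y * psi (level f i / n%:R))%:E).
  apply: ge0_le_integral => //.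
  - by move=> y _; rewrite sumEFin lee_fin sumr_ge0.
  - by apply: emeasurable_sum => i; exact/measurable_EFinP.
  - exact/measurable_EFinP.
  - by move=> y _; rewrite sumEFin lee_fin sum_increment_psi.
rewrite ge0_integral_sum //.
- apply: eq_bigr => i _; rewrite EFinM -integral_increment // -ge0_integralZr ?lee_fin //.
    by apply/measurable_EFinP; exact: measurable_increment.
  by move=> y _; rewrite lee_fin increment_ge0.
- by move=> i; exact/measurable_EFinP.
- by move=> i y _; rewrite lee_fin.
Qed.

Lemma ln_index_ge0 (n i : nat) : (0 <= ln (1 + i%:R / n%:R) :> R)%R.
Proof. by rewrite ln_ge0 // lerDl divr_ge0. Qed.

(** The 1 on the left is the total probability of the picks, multiplying the 1 of [ln_index_le]. It
    is not subtracted because the integral may be infinite; the net constant is 1/2. *)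
Lemma sum_index_cost (n : nat) : (0 < n)%N ->
  \sum_(i <oo) (pick_prob f i * ln (1 + i%:R / n%:R))%:E + 1 <=
  (3 / 2)%:E + \int[rho]_y (n%:R * Psi (f y / n%:R))%:E.
Proof.
move=> n0; rewrite -[X in _ + X]sum_pick_prob_eq1 -nneseriesD.
- apply: lime_le.
    apply: is_cvg_nneseries => i _ _; rewrite -EFinD lee_fin.
    by apply: addr_ge0; [apply: mulr_ge0|]; rewrite ?ln_index_ge0 ?pick_prob_ge0.
  apply: nearW => N; rewrite big_mkord; apply: le_trans (sum_index_cost_partial N n0).
  by apply: lee_sum => i _; rewrite -EFinD mulrDr mulr1.
- by move=> i _ _; rewrite lee_fin; apply: mulr_ge0; rewrite ?ln_index_ge0 ?pick_prob_ge0.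
- by move=> i _ _; rewrite lee_fin pick_prob_ge0.
Qed.

End density.
End greedy.

(** * Selection from a random sequence *)

Section selection.
Context {R : realType} {dX dY dZ : measure_display} {X : measurableType dX}
  {Y : measurableType dY} {Z : measurableType dZ}.
Variables (rho : probability Y R) (f : X * Y -> R).
Variables (PZ : probability Z R) (c : nat -> Z -> Y * measurableTypeR R).
Local Open Scope ereal_scope.

Local Notation fx x := (fun y => f (x, y)).
Local Notation sv x i := (survival rho (fx x) i).
Local Notation lv x i := (level rho (fx x) i).

Definition hit i : set (X * Z) := [set p | accept_at rho (fx p.1) i (c i p.2)].
Definition Sel i : set (X * Z) := [set p | hit i p /\ forall j, (j < i)%N -> ~ hit j p].
(* [Nosel] is negligible, so the value [point] given there to [sel_value] is
   immaterial; the infinite cost makes cost bounds hold trivially when it is not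
   negligible for a particular [z]. *)
Definition Nosel : set (X * Z) := ~` \bigcup_i Sel i.
Definition sel_index (p : X * Z) : nat := xget 0%N [set i | Sel i p].
Definition sel_value (p : X * Z) : Y :=
  if pselect (Nosel p) is left _ then point else (c (sel_index p) p.2).1.
Definition sel_cost (w : nat -> \bar R) (p : X * Z) : \bar R :=
  if pselect (Nosel p) is left _ then +oo else w (sel_index p).

Lemma Sel_inj i j p : Sel i p -> Sel j p -> i = j.
Proof.
move=> [hi ni] [hj nj]; case: (ltngtP i j) => // ij; first by case: (nj i ij).
by case: (ni j ij).
Qed.

Lemma trivIset_Sel : trivIset setT Sel.
Proof. by move=> i j _ _ [p [Si Sj]]; exact: (Sel_inj Si Sj). Qed.

Lemma sel_indexE i p : Sel i p -> sel_index p = i.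
Proof.
by move=> Si; rewrite /sel_index; case: xgetP => [j _ Sj|/(_ i)//]; exact: Sel_inj Sj Si.
Qed.

Lemma sel_valueE i p : Sel i p -> sel_value p = (c i p.2).1.
Proof.
move=> Si; rewrite /sel_value (sel_indexE Si); case: pselect => // -[].
by exists i.
Qed.

Lemma sel_costE w i p : Sel i p -> sel_cost w p = w i.
Proof.
move=> Si; rewrite /sel_cost (sel_indexE Si); case: pselect => // -[].
by exists i.
Qed.

Lemma sel_cost_ge0 w p : (forall i, 0 <= w i) -> 0 <= sel_cost w p.
Proof. by move=> w0; rewrite /sel_cost; case: pselect. Qed.

Hypothesis mf : measurable_fun setT f.
Hypothesis f0 : forall p, (0 <= f p)%R.
Hypothesis f1 : forall x, \int[rho]_y (f (x, y))%:E = 1.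
Hypothesis mc : forall i, measurable_fun setT (c i).
Hypothesis PZ_rect : forall N (B : nat -> set (Y * measurableTypeR R)),
  (forall i, measurable (B i)) ->
  PZ [set z | forall i, (i < N)%N -> B i (c i z)] = \prod_(i < N) marked rho (B i).

Let mfx x : measurable_fun setT (fx x).
Proof. exact: (measurableT_comp mf (pair1_measurable x)). Qed.

(** The recursion goes through measures of sections, so measurability in [x] is carried along; joint
    measurability of the selection in [(x, z)] rests on it. *)
Lemma measurable_levels i :
  measurable_fun setT (fun x => sv x i) /\ measurable_fun setT (fun x => lv x i).
Proof.
elim: i => [|i [ms mS]]; first by split; exact: measurable_cst.
have mS' : measurable_fun setT (fun x => lv x i.+1).
  exact: measurable_funD.
split=> //; rewrite (_ : (fun x => _) =
  (fun x => sv x i * (1 - fine (marked rho (accept_at rho (fx x) i))))%R) //.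
apply: measurable_funM => //; apply: measurable_funB => //.
apply: (measurableT_comp (@fine_measurable R setT measurableT)).
pose C : set (X * (Y * measurableTypeR R)) :=
  [set p | (lv p.1 i + sv p.1 i * p.2.2 < f (p.1, p.2.1))%R].
have mC : measurable C.
  have : measurable_fun setT (fun p : X * (Y * measurableTypeR R) =>
      (lv p.1 i + sv p.1 i * p.2.2 < f (p.1, p.2.1))%R).
    apply: measurable_fun_ltr.
      apply: measurable_funD; first exact: (measurableT_comp mS measurable_fst).
      apply: measurable_funM; first exact: (measurableT_comp ms measurable_fst).
      exact: (measurableT_comp measurable_snd measurable_snd).
    apply: (measurableT_comp mf); apply: measurable_fun_pair => //.
    exact: (measurableT_comp measurable_fst measurable_snd).
  by move=> /(_ measurableT [set true] I); rewrite setTI.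
have := measurable_fun_xsection (marked rho) mC; apply: eq_measurable_fun => x _ /=.
congr (marked rho _); apply/seteqP; split=> p; rewrite xsectionE //.
Qed.

Lemma measurable_hit i : measurable (hit i).
Proof.
have [ms mS] := measurable_levels i.
have : measurable_fun setT (fun p : X * Z =>
    (lv p.1 i + sv p.1 i * (c i p.2).2 < f (p.1, (c i p.2).1))%R).
  have mcs : measurable_fun setT (fun p : X * Z => c i p.2).
    exact: (measurableT_comp (mc i) measurable_snd).
  apply: measurable_fun_ltr.
    apply: measurable_funD; first exact: (measurableT_comp mS measurable_fst).
    apply: measurable_funM; first exact: (measurableT_comp ms measurable_fst).
    exact: (measurableT_comp measurable_snd mcs).
  apply: (measurableT_comp mf); apply: measurable_fun_pair => //.
  exact: (measurableT_comp measurable_fst mcs).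
by move=> /(_ measurableT [set true] I); rewrite setTI.
Qed.

Lemma measurable_Sel i : measurable (Sel i).
Proof.
rewrite (_ : Sel i = hit i `&` \bigcap_(j in `I_i) ~` hit j) //.
apply: measurableI; first exact: measurable_hit.
by apply: bigcap_measurableType => j _; apply: measurableC; exact: measurable_hit.
Qed.

Lemma measurable_Nosel : measurable Nosel.
Proof. by apply: measurableC; apply: bigcupT_measurable; exact: measurable_Sel. Qed.

Lemma measurable_piecewise d (T : measurableType d) (h : X * Z -> T)
    (hi : nat -> X * Z -> T) (t : T) :
  (forall i, measurable_fun setT (hi i)) -> (forall i p, Sel i p -> h p = hi i p) ->
  (forall p, Nosel p -> h p = t) -> measurable_fun setT h.
Proof.
move=> mhi hE ht; rewrite -(setUv (\bigcup_i Sel i)).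
apply/measurable_funU => //; [|exact: measurable_Nosel|].
  by apply: bigcupT_measurable; exact: measurable_Sel.
split.
  apply/measurable_fun_bigcup; first exact: measurable_Sel.
  move=> i; apply: (@eq_measurable_fun _ _ _ _ _ (hi i)).
    by move=> p /set_mem /hE.
  exact: measurable_funTS.
apply: (@eq_measurable_fun _ _ _ _ _ (cst t)) => //.
by move=> p /set_mem /ht.
Qed.

Lemma measurable_sel_value : measurable_fun setT sel_value.
Proof.
apply: (measurable_piecewise (hi := fun i p => (c i p.2).1) (t := point)).
- move=> i; apply: (measurableT_comp measurable_fst).
  exact: (measurableT_comp (mc i) measurable_snd).
- by move=> i p /sel_valueE.
- by move=> p np; rewrite /sel_value; case: pselect.
Qed.

Lemma measurable_sel_cost w : measurable_fun setT (sel_cost w).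
Proof.
apply: (measurable_piecewise (hi := fun i => cst (w i)) (t := +oo)) => //.
- by move=> i p /(sel_costE w).
- by move=> p np; rewrite /sel_cost; case: pselect.
Qed.

Lemma survival_prod x i :
  (sv x i)%:E = \prod_(j < i) marked rho (~` accept_at rho (fx x) j).
Proof.
elim: i => [|i IH]; first by rewrite big_ord0.
have mA : measurable (accept_at rho (fx x) i) by exact: accept_measurable.
rewrite big_ord_recr /= -IH probability_setC //.
by rewrite -[marked rho _]fineK ?fin_num_measure // -EFinB -EFinM.
Qed.

(** The event is a rectangle in the first [i.+1] rounds: rejections before round [i], then an
    acceptance with value in [B]. Independence factorizes it, and the rejections multiply to the
    survival probability. *)
Lemma PZ_Sel x i B : measurable B ->
  PZ (xsection (Sel i) x `&` [set z | B (c i z).1]) =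
  (sv x i)%:E * marked rho (accept_at rho (fx x) i `&` B `*` setT).
Proof.
move=> mB; pose A j := accept_at rho (fx x) j.
have mA j : measurable (A j) by exact: accept_measurable.
pose D j := if (j < i)%N then ~` A j else A i `&` B `*` setT.
have mD j : measurable (D j).
  rewrite /D; case: ifP => _; first exact: measurableC.
  by apply: measurableI => //; exact: measurableX.
rewrite survival_prod; transitivity (PZ [set z | forall j, (j < i.+1)%N -> D j (c j z)]).
  congr (PZ _); apply/seteqP; split=> z; rewrite xsectionE /=.
    move=> [[hi nh] Bz] j; rewrite ltnS leq_eqVlt => /predU1P[->|ji].
      by rewrite /D ltnn; split=> //; exact: hi.
    by rewrite /D ji => /nh; apply.
  move=> h; have := h i (ltnSn i); rewrite /D ltnn => -[Az [Bz _]].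
  split=> //; split=> // j ji.
  by have := h j (ltn_trans ji (ltnSn i)); rewrite /D ji.
have Di : D i = A i `&` B `*` setT by rewrite /D ltnn.
rewrite (PZ_rect i.+1 mD).
rewrite big_ord_recr.
apply: (f_equal2 mule).
  by apply: eq_bigr => j _; rewrite /D /= ltn_ord.
by rewrite [D _]Di.
Qed.

Let mxs (A : set (X * Z)) x : measurable A -> measurable (xsection A x).
Proof. exact: measurable_xsection. Qed.

Let mcB i B : measurable B -> measurable [set z | B (c i z).1].
Proof.
move=> mB; rewrite -[X in measurable X]setTI.
exact: (measurableT_comp measurable_fst (mc i)).
Qed.

Lemma PZ_bigcup_Sel x B : measurable B ->
  PZ (\bigcup_i (xsection (Sel i) x `&` [set z | B (c i z).1])) =
  \int[rho]_(y in B) (f (x, y))%:E.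
Proof.
move=> mB; rewrite -sum_accept_law // measure_bigcup //.
- rewrite (eq_eseriesl (Q := xpredT)); last by move=> i; rewrite in_setT.
  by apply: eq_eseriesr => i _; exact: PZ_Sel.
- move=> i _; apply: measurableI; last exact: mcB.
  by apply: mxs; exact: measurable_Sel.
- move=> i j _ _ [z [[/xsectionP Si _] [/xsectionP Sj _]]]; exact: Sel_inj Si Sj.
Qed.

(** The disjoint selection events already carry the whole mass of the density, which is 1. *)
Lemma PZ_Nosel x : PZ (xsection Nosel x) = 0.
Proof.
have mN := mxs x measurable_Nosel.
have -> : xsection Nosel x = ~` \bigcup_i (xsection (Sel i) x `&` [set z | setT (c i z).1]).
  rewrite xsectionE; apply/seteqP; split=> z /= h [i _].
    by move=> [/xsectionP Si _]; apply: h; exists i.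
  by move=> Si; apply: h; exists i => //; split=> //; exact/xsectionP.
rewrite probability_setC; last first.
  apply: bigcupT_measurable => i; apply: measurableI; last exact: mcB.
  by apply: mxs; exact: measurable_Sel.
by rewrite PZ_bigcup_Sel // f1 subee.
Qed.

Lemma sel_value_law x B : measurable B ->
  PZ [set z | B (sel_value (x, z))] = \int[rho]_(y in B) (f (x, y))%:E.
Proof.
move=> mB; rewrite -PZ_bigcup_Sel //; set U := \bigcup_i _.
have mU : measurable U.
  apply: bigcupT_measurable => i; apply: measurableI; last exact: mcB.
  by apply: mxs; exact: measurable_Sel.
have mV : measurable [set z | B (sel_value (x, z))].
  rewrite -[X in measurable X]setTI.
  by apply: (measurableT_comp measurable_sel_value (pair1_measurable x)).
have mN := mxs x measurable_Nosel.
have U1 : U `<=` [set z | B (sel_value (x, z))].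
  by move=> z [i _ [/xsectionP Si Bz]]; rewrite /= (sel_valueE Si).
have U2 : [set z | B (sel_value (x, z))] `<=` U `|` xsection Nosel x.
  move=> z /= Bz; have [N|/contrapT[i _ Si]] := pselect (Nosel (x, z)).
    by right; exact/xsectionP.
  by left; exists i => //; split; [exact/xsectionP|rewrite (sel_valueE Si) in Bz].
apply/eqP; rewrite eq_le; apply/andP; split; last by apply: le_measure; rewrite ?inE.
apply: (@le_trans _ _ (PZ (U `|` xsection Nosel x))).
  by apply: le_measure; rewrite ?inE //; exact: measurableU.
apply: le_trans (measureU2 _ _ _) _ => //.
by rewrite [X in _ + X](PZ_Nosel x) adde0.
Qed.

Lemma integral_sel_cost w x : (forall i, 0 <= w i) ->
  \int[PZ]_z sel_cost w (x, z) = \sum_(i <oo) (pick_prob rho (fx x) i)%:E * w i.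
Proof.
move=> w0; have mN := mxs x measurable_Nosel.
have mcost : measurable_fun setT (fun z => sel_cost w (x, z)).
  exact: (measurableT_comp (measurable_sel_cost w) (pair1_measurable x)).
rewrite (ge0_negligible_integral mN) //; last 2 first.
- by move=> z _; exact: sel_cost_ge0.
- exact: PZ_Nosel.
have -> : setT `\` xsection Nosel x = \bigcup_i xsection (Sel i) x.
  rewrite setTD /Nosel xsectionE; apply/seteqP; split=> z /=.
    by move=> /contrapT[i _ Si]; exists i => //; exact/xsectionP.
  by move=> [i _ /xsectionP Si]; apply; exists i.
rewrite ge0_integral_bigcup //.
- apply: eq_eseriesr => i _.
  rewrite (eq_integral (cst (w i))); last first.
    by move=> z /set_mem /xsectionP Si; rewrite (sel_costE w Si).
  rewrite integral_cst; last by apply: mxs; exact: measurable_Sel.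
  rewrite muleC; congr (_ * _).
  have -> : xsection (Sel i) x = xsection (Sel i) x `&` [set z | setT (c i z).1].
    by apply/seteqP; split=> z // -[].
  rewrite [LHS](PZ_Sel x i measurableT) setXTT setIT.
  rewrite /pick_prob EFinM fineK // fin_num_measure //; exact: accept_measurable.
- by move=> i; apply: mxs; exact: measurable_Sel.
- exact: measurable_funTS.
- by move=> z _; exact: sel_cost_ge0.
- move=> i j _ _ [z [/xsectionP Si /xsectionP Sj]]; exact: Sel_inj Si Sj.
Qed.

End selection.

(** * Variational bound for the mutual information *)

Section joint_measure.
Context {R : realType} {dX dY : measure_display} {X : measurableType dX}
  {Y : measurableType dY}.
Variables (mu : probability X R) (Q : R.-pker X ~> Y).
Local Open Scope ereal_scope.

Lemma measurable_kernel_xsection (C : set (X * Y)) : measurable C ->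
  measurable_fun setT (fun x => Q x (xsection C x)).
Proof. by move=> mC; apply: measurable_fun_xsection_finite_kernel; rewrite inE. Qed.

Let joint0 : joint_law mu Q set0 = 0.
Proof. by rewrite /joint_law integral0_eq // => x _; rewrite xsection0. Qed.

Let joint_ge0 C : 0 <= joint_law mu Q C.
Proof. exact: integral_ge0. Qed.

Let joint_sigma_additive : semi_sigma_additive (joint_law mu Q).
Proof.
move=> F mF tF mUF.
rewrite [X in _ --> X](_ : _ = \sum_(n <oo) joint_law mu Q (F n)).
  by apply/cvg_closeP; split; [exact: is_cvg_nneseries|rewrite closeE].
rewrite -integral_nneseries//; last by move=> n; exact: measurable_kernel_xsection.
apply: eq_integral => x _; apply/esym/cvg_lim => //=; rewrite xsection_bigcup.
apply: (measure_sigma_additive _ (trivIset_xsection tF)) => ?.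
exact: measurable_xsection.
Qed.

HB.instance Definition _ := isMeasure.Build _ _ _ (joint_law mu Q)
  joint0 joint_ge0 joint_sigma_additive.

Let jointT : joint_law mu Q setT = 1.
Proof.
rewrite /joint_law (eq_integral (cst 1)).
  by rewrite integral_cst //= probability_setT mule1.
by move=> x _; rewrite xsectionE preimage_setT prob_kernel.
Qed.

Definition joint : probability (X * Y)%type R := mprob jointT.

Lemma jointE C : joint C = joint_law mu Q C.
Proof. by []. Qed.

Let output_sigma_additive : semi_sigma_additive (output_law mu Q).
Proof.
move=> F mF tF mUF.
rewrite [X in _ --> X](_ : _ = \sum_(n <oo) output_law mu Q (F n)).
  by apply/cvg_closeP; split;
    [apply: is_cvg_nneseries => n _ _; exact: integral_ge0|rewrite closeE].
rewrite -integral_nneseries//; last by move=> n; exact: measurable_kernel.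
by apply: eq_integral => x _; apply/esym/cvg_lim => //=; exact: measure_sigma_additive.
Qed.

Let output0 : output_law mu Q set0 = 0.
Proof. by rewrite /output_law integral0_eq. Qed.

Let output_ge0 C : 0 <= output_law mu Q C.
Proof. exact: integral_ge0. Qed.

HB.instance Definition _ := isMeasure.Build _ _ _ (output_law mu Q)
  output0 output_ge0 output_sigma_additive.

Let outputT : output_law mu Q setT = 1.
Proof.
rewrite /output_law (eq_integral (cst 1)).
  by rewrite integral_cst //= probability_setT mule1.
by move=> x _; rewrite prob_kernel.
Qed.

Definition output : probability Y R := mprob outputT.

Lemma outputE B : output B = output_law mu Q B.
Proof. by []. Qed.

Lemma joint_rectE A B : measurable A -> measurable B ->
  joint_rect mu Q A B = joint (A `*` B).
Proof.
move=> mA mB; rewrite jointE /joint_law /joint_rect integral_mkcond.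
apply: eq_integral => x _; rewrite patchE; case: ifPn => xA.
  by rewrite in_xsectionX.
by rewrite notin_xsectionX // measure0.
Qed.

Lemma joint_setXT A : measurable A -> joint (A `*` setT) = mu A.
Proof.
move=> mA; rewrite -joint_rectE // /joint_rect (eq_integral (cst 1)).
  by rewrite integral_cst // mul1e.
by move=> x _; rewrite prob_kernel.
Qed.

Lemma joint_setTX B : measurable B -> joint (setT `*` B) = output B.
Proof. by move=> mB; rewrite -joint_rectE. Qed.

End joint_measure.

(** * Finite rectangular grids and approximation by grid sets *)

Section variational.
Context {R : realType} {dX dY : measure_display} {X : measurableType dX}
  {Y : measurableType dY}.
Variables (mu : probability X R) (Q : R.-pker X ~> Y).
Local Open Scope ereal_scope.

Local Notation J := (joint mu Q).
Local Notation out := (output mu Q).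

Definition product_law : probability (X * Y)%type R := mu \x out.

Definition fiber_measurable d (T : measurableType d) (K : finType) (h : T -> K) :=
  forall k, measurable (h @^-1` [set k]).

(** Functions constant on the cells of a finite product partition, the only objects that
    [mutual_info] sees directly. The codomain is arbitrary so that sets, through boolean functions,
    and real functions share the same closure properties. *)
Definition gridfun (S : Type) (u : X * Y -> S) :=
  exists (K L : finType) (h : X -> K) (g : Y -> L) (phi : K -> L -> S),
    [/\ fiber_measurable h, fiber_measurable g & forall p, u p = phi (h p.1) (g p.2)].

(** Young's inequality [p * ln (p / q) >= p + p * phi - q * expR phi] at [q = a * b]; the bounds of
    [p] by [a] and [b] keep [q] positive when [p] is. *)
Lemma mi_term_ge (p a b phi : R) : (0 <= a)%R -> (0 <= b)%R -> (0 <= p)%R ->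
  (p <= a)%R -> (p <= b)%R ->
  (p + p * phi - a * b * expR phi <= mi_term p a b * ln 2)%R.
Proof.
move=> a0 b0; rewrite /mi_term le_eqVlt => /predU1P[<-|p0] pa pb.
  rewrite eqxx !mul0r !add0r oppr_le0 mulr_ge0 ?expR_ge0 // mulr_ge0 //.
rewrite gt_eqF // /log2 -[X in (_ <= X)%R]mulrA divfK ?gt_eqF ?ln2_gt0 //.
have a00 : (0 < a)%R by exact: lt_le_trans pa.
have b00 : (0 < b)%R by exact: lt_le_trans pb.
have ab0 : (0 < a * b)%R by rewrite mulr_gt0.
have := @ln_ge1BV _ (p / (a * b) / expR phi)%R.
rewrite !divr_gt0 ?expR_gt0 // => /(_ isT).
rewrite ln_div ?posrE ?divr_gt0 ?expR_gt0 // expRK !invf_div.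
move=> /(ler_wpM2l (ltW p0)); rewrite mulrBr mulr1.
have -> : (p * (expR phi * (a * b / p)) = a * b * expR phi)%R.
  by field; rewrite gt_eqF.
lra.
Qed.

Section cells.
Variables (K L : finType) (h : X -> K) (g : Y -> L).
Hypotheses (mh : fiber_measurable h) (mg : fiber_measurable g).

Definition cell (q : K * L) : set (X * Y) := (h @^-1` [set q.1]) `*` (g @^-1` [set q.2]).

Lemma measurable_cell q : measurable (cell q).
Proof. exact: measurableX. Qed.

Lemma integral_cells (m : probability (X * Y)%type R) (phi : K * L -> R) :
  (forall q, 0 <= phi q)%R ->
  \int[m]_p (phi (h p.1, g p.2))%:E = (\sum_q phi q * fine (m (cell q)))%:E.
Proof.
move=> phi0.
rewrite (eq_integral (fun p => \sum_(q : K * L) (phi q * \1_(cell q) p)%:E)); last first.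
  move=> p _; rewrite sumEFin (bigD1 (h p.1, g p.2)) //= indicE mem_set // mulr1.
  rewrite big1 ?addr0 // => q qp; rewrite indicE memNset ?mulr0 // => -[/= hq gq].
  by case/eqP : qp; case: q hq gq => a b /= -> ->.
rewrite ge0_integral_sum //.
- rewrite -sumEFin; apply: eq_bigr => q _.
  under eq_integral do rewrite EFinM.
  rewrite ge0_integralZl_EFin //.
  + rewrite integral_indic ?setIT //; last exact: measurable_cell.
    rewrite EFinM fineK // fin_num_measure //; exact: measurable_cell.
  + by apply/measurable_EFinP; apply: measurable_indic; exact: measurable_cell.
- move=> q; apply/measurable_EFinP; apply: measurable_funM => //.
  by apply: measurable_indic; exact: measurable_cell.
- by move=> q p _; rewrite lee_fin mulr_ge0.
Qed.

Lemma sum_cells (m : probability (X * Y)%type R) : (\sum_q fine (m (cell q)) = 1)%R.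
Proof.
have := @integral_cells m (fun _ => 1%R) (fun _ => ler01).
rewrite integral_cst //= probability_setT mule1 => -[->].
by apply: eq_bigr => q _; rewrite mul1r.
Qed.

(** Sum of [mi_term_ge] over the cells; the leading 1 is the total mass of the joint law. *)
Lemma cells_variational (I : R) (phi : K * L -> R) : mutual_info mu Q = I%:E ->
  (1 + \sum_q phi q * fine (J (cell q)) <=
   I * ln 2 + \sum_q expR (phi q) * fine (product_law (cell q)))%R.
Proof.
move=> IE.
pose A (i : 'I_#|K|) := h @^-1` [set enum_val i].
pose B (j : 'I_#|L|) := g @^-1` [set enum_val j].
have part d (T : measurableType d) (M : finType) (e : T -> M) : fiber_measurable e ->
    finite_partition (fun i : 'I_#|M| => e @^-1` [set enum_val i]).
  move=> me; split; first by move=> i; exact: me.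
    move=> i j ij; apply/seteqP; split=> x //= -[xi xj].
    by case/eqP : ij; apply: enum_val_inj; rewrite -xi -xj.
  apply/seteqP; split=> x // _; exists (enum_rank (e x)) => //=.
  by rewrite enum_rankK.
have mA i : measurable (A i) by exact: mh.
have mB j : measurable (B j) by exact: mg.
pose t (k : K) (l : L) : R := mi_term (fine (joint_rect mu Q (h @^-1` [set k]) (g @^-1` [set l])))
  (fine (mu (h @^-1` [set k]))) (fine (output_law mu Q (g @^-1` [set l]))).
have tI : (\sum_(q : K * L) t q.1 q.2 <= I)%R.
  rewrite -lee_fin -IE; apply: ereal_sup_ubound => /=.
  exists #|K|, #|L|, A, B; split; [exact: part|exact: part|].
  congr EFin; rewrite -(pair_bigA _ t) /= (reindex _ (onW_bij _ (@enum_val_bij K))) /=.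
  by apply: eq_bigr => i _; rewrite (reindex _ (onW_bij _ (@enum_val_bij L))).
have ln20 : (0 <= ln 2 :> R)%R by rewrite ltW // ln2_gt0.
suff h1 : (1 + \sum_q phi q * fine (J (cell q)) <=
    (\sum_(q : K * L) t q.1 q.2) * ln 2 + \sum_q expR (phi q) * fine (product_law (cell q)))%R.
  by apply: le_trans h1 _; rewrite lerD2r ler_wpM2r.
rewrite -lerBlDr -[X in (X + _ - _ <= _)%R](sum_cells J) -big_split /= -sumrB mulr_suml.
apply: ler_sum => -[k l] _ /=.
have fp C : measurable C -> J C \is a fin_num by move=> mC; rewrite fin_num_measure.
have mk := mh k; have ml := mg l.
rewrite /t /= joint_rectE // -outputE.
rewrite [product_law _]product_measure1E // fineM ?fin_num_measure //.
have := @mi_term_ge (fine (J (cell (k, l)))) (fine (mu (h @^-1` [set k])))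
  (fine (out (g @^-1` [set l]))) (phi (k, l)).
rewrite ?fine_ge0 ?measure_ge0 // => /(_ isT isT isT).
rewrite (mulrC (expR _)) (mulrC (phi _)); apply.
  rewrite fine_le ?fin_num_measure //; first exact: measurable_cell.
  rewrite -(joint_setXT mu Q mk) le_measure ?inE //; first exact: measurable_cell.
    exact: measurableX.
  by apply: setSX.
rewrite fine_le ?fin_num_measure //; first exact: measurable_cell.
rewrite -(joint_setTX mu Q ml) le_measure ?inE //; first exact: measurable_cell.
  exact: measurableX.
by move=> p [].
Qed.

End cells.
Lemma gridfun_measurable S (u : X * Y -> S) (D : set S) : gridfun u ->
  measurable (u @^-1` D).
Proof.
move=> [K [L [h [g [phi [mh mg uE]]]]]].
rewrite (_ : u @^-1` D = \bigcup_(q in [set q | D (phi q.1 q.2)]) cell h g q).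
  by apply: fin_bigcup_measurable => // q _; exact: measurable_cell.
apply/seteqP; split=> p /=; first by rewrite uE => Dp; exists (h p.1, g p.2).
by move=> [q Dq [/= hq gq]]; rewrite uE hq gq.
Qed.

Lemma gridfun_comp2 S1 S2 S3 (F : S1 -> S2 -> S3) (u : X * Y -> S1) (v : X * Y -> S2) :
  gridfun u -> gridfun v -> gridfun (fun p => F (u p) (v p)).
Proof.
move=> [K [L [h [g [phi [mh mg uE]]]]]] [K' [L' [h' [g' [phi' [mh' mg' vE]]]]]].
have mpair d (T : measurableType d) (M M' : finType) (e : T -> M) (e' : T -> M') :
    fiber_measurable e -> fiber_measurable e' -> fiber_measurable (fun x => (e x, e' x)).
  move=> me me' [k k'].
  rewrite (_ : _ @^-1` _ = e @^-1` [set k] `&` e' @^-1` [set k']).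
    by apply: measurableI; [exact: me|exact: me'].
  by apply/seteqP; split=> x /=; [move=> [-> ->]|move=> [-> ->]].
exists (K * K')%type, (L * L')%type, (fun x => (h x, h' x)), (fun y => (g y, g' y)),
  (fun k l => F (phi k.1 l.1) (phi' k.2 l.2)); split; [exact: mpair|exact: mpair|].
by move=> p; rewrite uE vE.
Qed.

Lemma gridfun_cst S (a : S) : gridfun (fun=> a).
Proof.
exists unit, unit, (fun=> tt), (fun=> tt), (fun _ _ => a); split=> // -[];
  by rewrite (_ : _ @^-1` _ = setT) //; apply/seteqP; split=> // x _; case: (_ x).
Qed.

Lemma gridfun_rect A B : measurable A -> measurable B ->
  gridfun (fun p => p \in A `*` B).
Proof.
move=> mA mB; exists bool, bool, (fun x => x \in A), (fun y => y \in B), andb.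
have mbool d (T : measurableType d) (D : set T) : measurable D ->
    fiber_measurable (fun x => x \in D).
  move=> mD [].
    rewrite (_ : _ @^-1` _ = D) //.
    by apply/seteqP; split=> x /= => [/set_mem|/mem_set].
  rewrite (_ : _ @^-1` _ = ~` D); first exact: measurableC.
  apply/seteqP; split=> x /=; last by move=> h; apply/negbTE; rewrite notin_setE.
  by move=> /negbT; rewrite notin_setE.
split; [exact: mbool|exact: mbool|].
by move=> [x y] /=; apply/idP/andP; rewrite !inE.
Qed.

Local Notation nu := (measure_add J product_law).

Definition setsd (C G : set (X * Y)) := (C `\` G) `|` (G `\` C).

(** The error is measured by the sum of the joint and product laws, so that one grid set serves both
    sides of the variational inequality. Such sets form a sigma-algebra containing the
    rectangles. *)
Definition approximable (C : set (X * Y)) := measurable C /\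
  forall e : R, (0 < e)%R -> exists G, gridfun (fun p => p \in G) /\ nu (setsd C G) <= e%:E.

Lemma gridset_measurable G : gridfun (fun p => p \in G) -> measurable G.
Proof.
move=> /(gridfun_measurable [set true]); rewrite (_ : _ @^-1` _ = G) //.
by apply/seteqP; split=> p /= => [/set_mem|/mem_set].
Qed.

Lemma measurable_setsd C G : measurable C -> measurable G -> measurable (setsd C G).
Proof. by move=> mC mG; apply: measurableU; exact: measurableD. Qed.

Lemma nu_fin C : measurable C -> nu C \is a fin_num.
Proof. by move=> mC; rewrite measure_addE fin_numD !fin_num_measure. Qed.

Lemma nu_setsdxx C : nu (setsd C C) = 0.
Proof. by rewrite /setsd setDv setU0 measure_addE !measure0 adde0. Qed.

Lemma approximableC C : approximable C -> approximable (~` C).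
Proof.
move=> [mC aC]; split; first exact: measurableC.
move=> e e0; have [G [gG CG]] := aC e e0; exists (~` G); split.
  have := gridfun_comp2 (fun b _ => ~~ b) gG (gridfun_cst tt).
  by congr gridfun; apply/funext => p; rewrite in_setC.
rewrite (_ : setsd _ _ = setsd C G) // /setsd !setDE !setCK setUC.
by rewrite setIC [X in _ `|` X]setIC.
Qed.

Lemma approximableU C D : approximable C -> approximable D -> approximable (C `|` D).
Proof.
move=> [mC aC] [mD aD]; split; first exact: measurableU.
move=> e e0; have e2 : (0 < e / 2)%R by rewrite divr_gt0.
have [G [gG CG]] := aC _ e2; have [H [gH DH]] := aD _ e2; exists (G `|` H); split.
  have := gridfun_comp2 orb gG gH.
  by congr gridfun; apply/funext => p; rewrite in_setU.
have mG := gridset_measurable gG; have mH := gridset_measurable gH.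
have m1 := measurable_setsd mC mG; have m2 := measurable_setsd mD mH.
apply: (@le_trans _ _ (nu (setsd C G `|` setsd D H))).
  apply: le_measure; rewrite ?inE; [|exact: measurableU|].
    by apply: measurable_setsd; exact: measurableU.
  move=> p [[CD GH]|[GH CD]].
    by case: CD => [Cp|Dp]; [left|right]; left; split=> // ?; apply: GH; [left|right].
  by case: GH => [Gp|Hp]; [left|right]; right; split=> // ?; apply: CD; [left|right].
apply: le_trans (measureU2 _ m1 m2) _.
by rewrite (splitr e) EFinD leeD.
Qed.

(** Continuity from above of the finite measure [nu] brings the union within [e / 2] of a finite
    union, which is approximated within another [e / 2]. *)
Lemma approximable_bigcup (C : nat -> set (X * Y)) :
  (forall n, approximable (C n)) -> approximable (\bigcup_n C n).
Proof.
move=> aC; have mC n : measurable (C n) by case: (aC n).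
have mU : measurable (\bigcup_n C n) by exact: bigcupT_measurable.
split=> // e e0; have e2 : (0 < e / 2)%R by rewrite divr_gt0.
pose D n := \big[setU/set0]_(k < n) C k.
have aD n : approximable (D n).
  elim: n => [|n IH]; last by rewrite /D big_ord_recr /=; exact: approximableU.
  rewrite /D big_ord0; split=> // e' e'0; exists set0; split.
    by have := gridfun_cst false; congr gridfun; apply/funext => p; rewrite in_set0.
  by rewrite nu_setsdxx lee_fin ltW.
pose E n := \bigcup_n C n `\` D n.
have mE n : measurable (E n) by apply: measurableD => //; have [] := aD n.
have cvE : nu (E n) @[n --> \oo] --> 0.
  have E0 : \bigcap_n E n = set0.
    apply/seteqP; split=> p // Ep; have [[n _ Cn] _] := Ep 0%N I.
    by have [_] := Ep n.+1 I; apply; rewrite /D big_ord_recr /=; right.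
  rewrite -[X in _ --> X](measure0 nu) -E0; apply: nonincreasing_cvg_mu => //.
  - by rewrite ltey_eq nu_fin.
  - by rewrite E0.
  - apply/nonincreasing_seqP => n; apply/subsetPset => p [Up nD]; split=> // h.
    by apply: nD; rewrite /D big_ord_recr /=; left.
have [n nuE] : exists n, nu (E n) <= (e / 2)%:E.
  have /fine_cvgP[_ /cvgrPdist_le /(_ _ e2)[n _ h]] := cvE.
  exists n; have := h n (leqnn n); rewrite /= sub0r normrN ger0_norm ?fine_ge0 //.
  by rewrite -lee_fin fineK // nu_fin.
have [mD /(_ _ e2)[G [gG DG]]] := aD n; exists G; split=> //.
have mG := gridset_measurable gG; have m1 := measurable_setsd mD mG.
apply: (@le_trans _ _ (nu (E n `|` setsd (D n) G))).
  apply: le_measure; rewrite ?inE; [exact: measurable_setsd|exact: measurableU|].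
  move=> p [[Up nG]|[Gp nU]].
    by have [Dp|nD] := pselect (D n p); [right; left|left].
  right; right; split=> // Dp; apply: nU; move: Dp; rewrite /D -bigcup_mkord.
  by move=> [k _ Ck]; exists k.
apply: le_trans (measureU2 _ (mE n) m1) _.
by rewrite (splitr e) EFinD leeD.
Qed.

Lemma measurable_approximable C : measurable C -> approximable C.
Proof.
rewrite measurable_prod_measurableType; apply: smallest_sub.
  split=> [|D aD|F aF]; last exact: approximable_bigcup.
    split=> // e e0; exists set0; split.
      by have := gridfun_cst false; congr gridfun; apply/funext => p; rewrite in_set0.
    by rewrite nu_setsdxx lee_fin ltW.
  by rewrite setTD; exact: approximableC.
move=> _ [A mA [B mB <-]]; split; first exact: measurableX.
move=> e e0; exists (A `*` B); split; first exact: gridfun_rect.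
by rewrite nu_setsdxx lee_fin ltW.
Qed.

End variational.

(** * The Donsker-Varadhan inequality and absolute continuity *)

Section variational_inequality.
Context {R : realType} {dX dY : measure_display} {X : measurableType dX}
  {Y : measurableType dY}.
Variables (mu : probability X R) (Q : R.-pker X ~> Y) (I : R).
Hypothesis IE : mutual_info mu Q = I%:E.
Local Open Scope ereal_scope.

Local Notation J := (joint mu Q).
Local Notation pi := (product_law mu Q).

Lemma variational_grid (u : X * Y -> R) (s : R) : gridfun u -> (forall p, 0 <= u p)%R ->
  \int[J]_p (u p)%:E + 1 <= (I * ln 2 + s)%:E + \int[pi]_p (expR (u p - s))%:E.
Proof.
move=> [K [L [h [g [phi [mh mg uE]]]]]] u0.
(* [phi] may be negative on pairs of labels that no point attains, whereas [integral_cells] asks for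
   nonnegativity at every pair. *)
pose phi' (q : K * L) := (Num.max 0 (phi q.1 q.2))%R.
have uE' p : u p = phi' (h p.1, g p.2) by rewrite /phi' /= -uE max_r.
have phi'0 q : (0 <= phi' q)%R by rewrite le_max lexx.
rewrite (eq_integral (fun p => (phi' (h p.1, g p.2))%:E)); last by move=> p _; rewrite uE'.
rewrite (integral_cells mh mg J phi'0).
rewrite (eq_integral (fun p => ((fun q => expR (phi' q - s)) (h p.1, g p.2))%:E)); last first.
  by move=> p _; rewrite uE'.
rewrite (integral_cells mh mg pi (fun q => expR_ge0 (phi' q - s))).
rewrite -!EFinD lee_fin.
have := cells_variational mh mg (fun q => phi' q - s)%R IE.
under eq_bigr do rewrite mulrBl.
rewrite sumrB -mulr_sumr sum_cells // mulr1; lra.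
Qed.

Lemma variational_simple (C : R -> set (X * Y)) (l : seq R) (s : R) :
  (forall y, measurable (C y)) -> (forall y, y \in l -> 0 <= y)%R ->
  forall u, (forall p, u p = \sum_(y <- l) y * \1_(C y) p)%R ->
  \int[J]_p (u p)%:E + 1 <= (I * ln 2 + s)%:E + \int[pi]_p (expR (u p - s))%:E.
Proof.
move=> mC l0 u0 u0E; pose u p := (\sum_(y <- l) y * \1_(C y) p)%R.
have -> : u0 = u by exact/funext.
set nu := measure_add J pi.
pose M := (\sum_(y <- l) y)%R.
have M0 : (0 <= M)%R by rewrite /M big_seq sumr_ge0.
have mu_ (C' : R -> set (X * Y)) : (forall y, measurable (C' y)) ->
    measurable_fun setT (fun p => \sum_(y <- l) y * \1_(C' y) p)%R.
  move=> mC'; apply: measurable_sum => y.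
  by apply: measurable_funM => //; exact: measurable_indic.
have u_ge0 (C' : R -> set (X * Y)) p : (0 <= \sum_(y <- l) y * \1_(C' y) p)%R.
  rewrite big_seq sumr_ge0 // => y yl.
  by apply: mulr_ge0; [exact: l0|rewrite indicE ler0n].
have u_leM (C' : R -> set (X * Y)) p : (\sum_(y <- l) y * \1_(C' y) p <= M)%R.
  rewrite /M big_seq [leRHS]big_seq ler_sum // => y yl.
  by rewrite ler_piMr ?l0 // indicE; case: (_ \in _).
(* Replacing each [C y] by a grid set changes [u] only on the exceptional set [D], where it costs at
   most [M] under the joint law and [expR (M - s)] under the product law; [c] collects both. *)
pose c := (expR (M - s) + M)%R.
have c0 : (0 <= c)%R by rewrite addr_ge0 ?expR_ge0.
apply/lee_addgt0Pr => e e0.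
pose e' := (e / ((size l).+1%:R * (c + 1)))%R.
have sc0 : (0 < (size l).+1%:R * (c + 1))%R by rewrite mulr_gt0 // ltr_wpDl.
have e'0 : (0 < e')%R by rewrite divr_gt0.
have /choice[G hG] y : exists G, gridfun (fun p => p \in G) /\ nu (setsd (C y) G) <= e'%:E.
  by have [_ /(_ _ e'0)] := measurable_approximable mu Q (mC y).
have mG y : measurable (G y) by apply: gridset_measurable; case: (hG y).
pose u' p := (\sum_(y <- l) y * \1_(G y) p)%R.
have gu' : gridfun u'.
  rewrite /u'; elim: (l) => [|y r IH].
    rewrite (_ : (fun p => _) = (fun=> 0%R)); first exact: gridfun_cst.
    by apply/funext => p; rewrite big_nil.
  have := gridfun_comp2 (fun (b : bool) v => y * b%:R + v)%R (hG y).1 IH.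
  rewrite (_ : (fun p => _) = (fun p => \sum_(y0 <- y :: r) y0 * \1_(G y0) p)%R) //.
  by apply/funext => p; rewrite big_cons indicE.
pose D := \big[setU/set0]_(y <- l) setsd (C y) (G y).
have mD : measurable D.
  by apply: bigsetU_measurable => y _; exact: measurable_setsd.
have nuD : nu D <= (e / (c + 1))%:E.
  have h : forall r : seq R, nu (\big[setU/set0]_(y <- r) setsd (C y) (G y)) <= ((size r)%:R * e')%:E.
    elim=> [|y r IH]; first by rewrite big_nil /nu measure_addE !measure0 adde0 mul0r.
    rewrite big_cons /=; apply: le_trans (measureU2 _ _ _) _.
    - exact: measurable_setsd.
    - by apply: bigsetU_measurable => y' _; exact: measurable_setsd.
    - by rewrite -natr1 mulrDl mul1r addrC EFinD leeD //; exact: (hG y).2.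
  apply: le_trans (h l) _; rewrite lee_fin ler_pdivlMr ?ltr_wpDl //.
  have -> : ((size l)%:R * e' * (c + 1) = (size l)%:R / (size l).+1%:R * e)%R.
    have aux (a b c' e1 : R) : (b != 0 -> c' != 0 -> a * (e1 / (b * c')) * c' = a / b * e1)%R.
      by move=> b0 c'0; field; rewrite b0 c'0.
    by apply: aux; rewrite gt_eqF // ltr_wpDl.
  by rewrite ler_piMl ?(ltW e0) // ler_pdivrMr // mul1r ler_nat.
have eqD p : ~ D p -> u p = u' p.
  move=> nD; rewrite /u /u' big_seq [RHS]big_seq; apply: eq_bigr => y yl.
  congr (_ * _)%R; rewrite !indicE; congr (nat_of_bool _)%:R.
  have nDy : ~ setsd (C y) (G y) p.
    by move=> h; apply: nD; rewrite /D -bigcup_seq; exists y.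
  apply/idP/idP; rewrite !inE => h; apply: contrapT => h'; apply: nDy; by [left|right].
have mu1 := mu_ C mC; have mu2 := mu_ G mG; rewrite -/u' in mu2.
have mI : measurable_fun setT (\1_D : X * Y -> R) by exact: measurable_indic.
have step1 : \int[J]_p (u p)%:E <= \int[J]_p (u' p)%:E + M%:E * J D.
  have -> : J D = \int[J]_p (\1_D p)%:E by rewrite integral_indic ?setIT.
  rewrite -ge0_integralZl_EFin //; last first.
    exact/measurable_EFinP.
  rewrite -ge0_integralD //; [|by move=> p _; rewrite lee_fin u_ge0|exact/measurable_EFinP|
    by move=> p _; rewrite -EFinM lee_fin mulr_ge0|
    by apply/measurable_EFinP; exact: measurable_funM].
  apply: ge0_le_integral => //.
  - by move=> p _; rewrite lee_fin u_ge0.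
  - exact/measurable_EFinP.
  - by apply/measurable_EFinP; apply: measurable_funD => //; exact: measurable_funM.
  - move=> p _; rewrite -EFinM -EFinD lee_fin indicE.
    have [Dp|nDp] := pselect (D p).
      by rewrite mem_set // mulr1 (le_trans (u_leM C p)) // lerDr u_ge0.
    by rewrite memNset // mulr0 addr0 eqD.
have mexp (v : X * Y -> R) : measurable_fun setT v ->
    measurable_fun setT (fun p => expR (v p - s)).
  by move=> mv; apply: measurableT_comp => //; exact: measurable_funB.
have step2 : \int[pi]_p (expR (u' p - s))%:E <=
    \int[pi]_p (expR (u p - s))%:E + (expR (M - s))%:E * pi D.
  have -> : pi D = \int[pi]_p (\1_D p)%:E by rewrite integral_indic ?setIT.
  rewrite -ge0_integralZl_EFin //; last first.
  - exact/measurable_EFinP.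
  rewrite -ge0_integralD //.
  all: try by [move=> p _; rewrite -EFinM lee_fin mulr_ge0 ?expR_ge0 |
    apply/measurable_EFinP; exact: mexp | apply/measurable_EFinP; exact: measurable_funM].
  apply: ge0_le_integral => //.
  - by apply/measurable_EFinP; exact: mexp.
  - apply/measurable_EFinP; apply: measurable_funD; first exact: mexp.
    exact: measurable_funM.
  - move=> p _; rewrite -EFinM -EFinD lee_fin indicE.
    have [Dp|nDp] := pselect (D p).
      by rewrite mem_set // mulr1 -[leLHS]add0r lerD ?expR_ge0 // ler_expR lerD2r u_leM.
    by rewrite memNset // mulr0 addr0 eqD.
have := variational_grid s gu' (fun p => u_ge0 G p).
have JD : J D <= nu D by rewrite /nu measure_addE leeDl.
have piD : pi D <= nu D by rewrite /nu measure_addE leeDr.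
move=> h; apply: (@le_trans _ _ (\int[J]_p (u' p)%:E + M%:E * J D + 1)).
  by rewrite leeD2r.
rewrite addeAC; apply: le_trans (leeD h (lexx _)) _.
apply: (@le_trans _ _ ((I * ln 2 + s)%:E + (\int[pi]_p (expR (u p - s))%:E +
   (expR (M - s))%:E * pi D) + M%:E * J D)).
  by rewrite leeD2r // leeD2l.
move: (\int[pi]_p (expR (u p - s))%:E) => W.
rewrite -!addeA; apply: leeD2l; apply: leeD2l.
apply: (@le_trans _ _ (c%:E * nu D)).
  rewrite /c EFinD ge0_muleDl ?lee_fin ?expR_ge0 //.
  by rewrite leeD // lee_wpmul2l // lee_fin expR_ge0.
apply: (@le_trans _ _ (c%:E * (e / (c + 1))%:E)); first by rewrite lee_wpmul2l ?lee_fin.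
rewrite -EFinM lee_fin mulrCA ler_piMr ?(ltW e0) // ler_pdivrMr ?mul1r ?ltr_wpDl //.
by rewrite lerDl.
Qed.

Import HBNNSimple.

Lemma variational_nnsfun (u : {nnsfun (X * Y)%type >-> R}) (s : R) :
  \int[J]_p (u p)%:E + 1 <= (I * ln 2 + s)%:E + \int[pi]_p (expR (u p - s))%:E.
Proof.
apply: (@variational_simple (fun y => u @^-1` [set y]) (finmap.enum_fset (fset_set (range u)))).
- by move=> y; exact: measurable_funPTI.
- by move=> y; rewrite in_fset_set // inE => -[p _ <-].
- by move=> p; rewrite fimfunE fsbig_finite.
Qed.

(* The Donsker-Varadhan inequality; the logarithm of the exponential moment is
   linearized at [s], so that infinite integrals need no special treatment. *)
Lemma variational (k : X * Y -> R) (s : R) : measurable_fun setT k ->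
  (forall p, 0 <= k p)%R ->
  \int[J]_p (k p)%:E + 1 <= (I * ln 2 + s)%:E + \int[pi]_p (expR (k p - s))%:E.
Proof.
move=> mk k0.
have mkE : measurable_fun setT (fun p => (k p)%:E) by exact/measurable_EFinP.
have kE0 p : setT p -> 0 <= (k p)%:E by rewrite lee_fin.
pose u_ n := nnsfun_approx measurableT mkE n.
have cvu : \int[J]_p (u_ n p)%:E @[n --> \oo] --> \int[J]_p (k p)%:E.
  rewrite (_ : (fun p => (k p)%:E) = (fun p => limn (fun n => (u_ n p)%:E))).
    apply: cvg_monotone_convergence => //.
    - by move=> n; apply/measurable_EFinP.
    - by move=> n p _; rewrite lee_fin.
    - move=> p _ m n mn; rewrite lee_fin.
      by have /lefP := nd_nnsfun_approx measurableT mkE mn; apply.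
  by apply/funext => p; apply/esym/cvg_lim => //; exact: cvg_nnsfun_approx.
have u_le n p : (u_ n p <= k p)%R by rewrite nnsfun_approxE -lee_fin; exact: (le_approx _ kE0).
rewrite -leeBrDr // -(cvg_lim _ cvu) //; apply: lime_le.
  by apply/cvg_ex; eexists; exact: cvu.
apply: nearW => n; rewrite leeBrDr //; apply: le_trans (variational_nnsfun _ s) _.
rewrite leeD2l //; apply: ge0_le_integral => //.
- by apply/measurable_EFinP; apply: measurableT_comp => //; exact: measurable_funB.
- by apply/measurable_EFinP; apply: measurableT_comp => //; exact: measurable_funB.
- by move=> p _; rewrite lee_fin ler_expR lerD2r u_le.
Qed.

(** Testing with [c] times the indicator of a null set leaves the exponential moment equal to 1, so
    [c * J C <= I * ln 2] for every [c >= 0]. *)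
Lemma joint_dominated C : measurable C -> pi C = 0 -> J C = 0.
Proof.
move=> mC piC.
have hc (c : R) : (0 <= c)%R -> c%:E * J C <= (I * ln 2)%:E.
  move=> c0; have mI : measurable_fun setT (fun p => c * \1_C p : R)%R.
    by apply: measurable_funM => //; exact: measurable_indic.
  have := variational 0%R mI; rewrite addr0 => /(_ (fun p => mulr_ge0 c0 (ler0n _ _))).
  under eq_integral do rewrite EFinM.
  rewrite ge0_integralZl_EFin //; last exact/measurable_EFinP/measurable_indic.
  rewrite integral_indic ?setIT //.
  rewrite [X in _ <= _ + X](_ : _ = 1).
    by rewrite leeD2rE.
  rewrite (ge0_negligible_integral mC) //; last first.
  - apply/measurable_EFinP; apply: measurableT_comp => //; exact: measurable_funB.
  rewrite (eq_integral (cst 1)).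
    rewrite integral_cst ?mul1e; last exact: measurableD.
    rewrite setTD; transitivity (1 - pi C); first exact: probability_setC.
    by rewrite piC sube0.
  by move=> p /set_mem[_ nC]; rewrite indicE memNset // mulr0 subr0 expR0.
have Jf : J C \is a fin_num by rewrite fin_num_measure.
apply/eqP; rewrite eq_le measure_ge0 andbT -(fineK Jf) lee_fin leNgt; apply/negP => j0.
have I0 : (0 <= I * ln 2)%R.
  by have := hc 0%R (lexx _); rewrite mul0e lee_fin.
have := hc ((I * ln 2 + 1) / fine (J C))%R.
rewrite divr_ge0 ?addr_ge0 ?(ltW j0) // => /(_ isT).
rewrite -[X in _ * X <= _](fineK Jf) -EFinM lee_fin divfK ?gt_eqF //; lra.
Qed.

End variational_inequality.

(** * Cost of the selected index *)

Lemma integral_product_xsection (R : realType) (dX dY : measure_display)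
    (X : measurableType dX) (Y : measurableType dY) (mu : probability X R)
    (rho : probability Y R) (h : X * Y -> \bar R) C :
  measurable C -> measurable_fun setT h -> (forall p, 0 <= h p)%E ->
  (\int[mu \x rho]_(p in C) h p = \int[mu]_x \int[rho]_(y in xsection C x) h (x, y))%E.
Proof.
move=> mC mh h0; rewrite integral_mkcond (fubini_tonelli1 (_ \_ C)); last 2 first.
- by apply/(measurable_restrictT _ mC); exact: measurable_funTS.
- by move=> p; rewrite patchE; case: ifP.
apply: eq_integral => x _; rewrite /fubini_F [RHS]integral_mkcond.
by apply: eq_integral => y _; rewrite !patchE mem_xsection.
Qed.

Section density_integral.
Context {R : realType} {d : measure_display} {T : measurableType d}.
Variables (m nu : {measure set T -> \bar R}) (f : T -> R).
Hypothesis mf : measurable_fun setT f.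
Hypothesis f0 : forall t, (0 <= f t)%R.
Local Open Scope ereal_scope.
Hypothesis nuE : forall C, measurable C -> nu C = \int[m]_(t in C) (f t)%:E.

Import HBNNSimple.

Lemma integral_density (h : T -> \bar R) : measurable_fun setT h ->
  (forall t, 0 <= h t) -> \int[nu]_t h t = \int[m]_t (h t * (f t)%:E).
Proof.
move=> mh h0; have h0' t : setT t -> 0 <= h t by [].
have mfE : measurable_fun setT (fun t => (f t)%:E) by exact/measurable_EFinP.
have indicC (C : set T) : measurable C ->
    \int[nu]_t (\1_C t)%:E = \int[m]_t ((\1_C t)%:E * (f t)%:E).
  move=> mC; rewrite integral_indic // setIT nuE // integral_mkcond.
  apply: eq_integral => t _; rewrite patchE indicE.
  by case: ifP => tC; rewrite ?mul1e ?mul0e.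
have simple (u : {nnsfun T >-> R}) :
    \int[nu]_t (u t)%:E = \int[m]_t ((u t)%:E * (f t)%:E).
  set l := finmap.enum_fset (fset_set (range u)).
  have l0 y : y \in l -> (0 <= y)%R by rewrite /l in_fset_set // inE => -[t _ <-].
  (* The maximum with 0 changes no value in the range of [u] and makes every coefficient
     nonnegative, including those indexed outside that range. *)
  have uE t : (u t)%:E = \sum_(y <- l) (Num.max 0 y)%:E * (\1_(u @^-1` [set y]) t)%:E.
    rewrite fimfunE fsbig_finite //= -sumEFin [LHS]big_seq [RHS]big_seq.
    by apply: eq_bigr => y yl; rewrite max_r ?l0.
  have mI y : measurable (u @^-1` [set y]) by exact: measurable_funPTI.
  have mI' y : measurable_fun setT (fun t => (\1_(u @^-1` [set y]) t)%:E : \bar R).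
    by apply/measurable_EFinP; exact: measurable_indic.
  have y0 (y : R) : (0 <= Num.max 0 y)%R by rewrite le_max lexx.
  under eq_integral do rewrite uE.
  under [RHS]eq_integral => t _.
    rewrite uE ge0_sume_distrl; last by move=> y _; rewrite -EFinM lee_fin mulr_ge0.
    over.
  rewrite !ge0_integral_sum //.
  - apply: eq_bigr => y _; rewrite ge0_integralZl_EFin // indicC //.
    under [RHS]eq_integral do rewrite -muleA.
    rewrite ge0_integralZl_EFin //.
    + by move=> t _; rewrite mule_ge0 // lee_fin.
    + exact: emeasurable_funM.
  - move=> y; apply: emeasurable_funM => //; exact: emeasurable_funM.
  - by move=> y t _; rewrite -!EFinM lee_fin !mulr_ge0.
  - by move=> y; exact: emeasurable_funM.
  - by move=> y t _; rewrite -EFinM lee_fin mulr_ge0.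
pose u_ k := nnsfun_approx measurableT mh k.
have nd t : nondecreasing_seq (fun k => (u_ k t)%:E).
  move=> i j ij; rewrite lee_fin.
  by have /lefP := nd_nnsfun_approx measurableT mh ij; apply.
have hE : h = (fun t => limn (fun k => (u_ k t)%:E)).
  by apply/funext => t; apply/esym/cvg_lim => //; exact: cvg_nnsfun_approx.
have cv1 : \int[nu]_t (u_ k t)%:E @[k --> \oo] --> \int[nu]_t h t.
  rewrite hE; apply: cvg_monotone_convergence => //.
  - by move=> k; apply/measurable_EFinP.
  - by move=> k t _; rewrite lee_fin.
have cv2 : \int[m]_t ((u_ k t)%:E * (f t)%:E) @[k --> \oo] --> \int[m]_t (h t * (f t)%:E).
  rewrite (_ : (fun t => h t * (f t)%:E) = (fun t => limn (fun k => (u_ k t)%:E * (f t)%:E))).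
    apply: cvg_monotone_convergence => //.
    - by move=> k; apply: emeasurable_funM => //; apply/measurable_EFinP.
    - by move=> k t _; rewrite mule_ge0 // lee_fin.
    - by move=> t _ i j ij; rewrite lee_wpmul2r ?lee_fin // -lee_fin; exact: nd.
  apply/funext => t; apply/esym/cvg_lim => //.
  by apply: cvgeZr => //; exact: cvg_nnsfun_approx.
rewrite -(cvg_lim _ cv1) // -(cvg_lim _ cv2) //; congr (limn _).
by apply/funext => k; exact: simple.
Qed.

End density_integral.

(** Elimination of [B] between two inequalities, by cases because [A] and [B] may be infinite a
    priori. *)
Lemma le_of_shifted_sums (R : realType) (A B : \bar R) (s h c : R) : (0 <= A -> 0 <= B ->
  A + s%:E <= B + h%:E -> B + 1 <= c%:E -> A <= (c + h - 1 - s)%:E)%E.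
Proof.
case: A => [a| |]; case: B => [b| |] //; rewrite ?addye ?leye_eq //.
by rewrite -!EFinD !lee_fin; lra.
Qed.

Section cost_bound.
Context {R : realType} {dX dY : measure_display} {X : measurableType dX}
  {Y : measurableType dY}.
Variables (mu : probability X R) (Q : R.-pker X ~> Y) (I : R).
Hypothesis IE : mutual_info mu Q = I%:E.
Variables (rho : probability Y R) (n : nat) (f : X * Y -> R).
Hypothesis n0 : (0 < n)%N.
Hypothesis mf : measurable_fun setT f.
Hypothesis f0 : forall p, (0 <= f p)%R.
Local Open Scope ereal_scope.
Hypothesis out_le : forall B, measurable B -> output mu Q B <= n%:R%:E * rho B.
Hypothesis fE : forall C, measurable C ->
  joint mu Q C = \int[mu \x rho]_(p in C) (f p)%:E.

Lemma Psi_le_square (p : R) : (0 <= p)%R -> (Psi p <= p ^+ 2)%R.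
Proof.
move=> p0; rewrite /Psi; case: (leP p 1%R) => p1; first nra.
have p1' : (0 < p)%R by lra.
have := ler_wpM2l p0 (le_lnB1 p1'); nra.
Qed.

(** Truncating the Radon-Nikodym derivative at [n] makes its bound hold everywhere. Where the
    derivative exceeds [n], the truncation integrates to [n] times the [rho]-mass, which still
    dominates the output law. *)
Lemma output_density : exists r : Y -> R, [/\ measurable_fun setT r,
  forall y, (0 <= r y <= n%:R)%R &
  forall B, measurable B -> output mu Q B = \int[rho]_(y in B) (r y)%:E].
Proof.
have dom : output mu Q `<< rho.
  apply/null_content_dominatesP => B mB rB; apply/eqP.
  by rewrite eq_le measure_ge0 andbT; have := out_le mB; rewrite rB mule0.
have [r0 [r0_ge0 r0_fin r0_int r0E]] :=
  @radon_nikodym_sigma_finite _ _ _ rho (output mu Q) dom.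
have mr0 := measurable_int _ r0_int.
pose r y := Num.min (fine (r0 y)) n%:R.
have mr : measurable_fun setT r.
  by apply: measurable_minr => //; exact: (measurableT_comp _ mr0).
have r_ge0 y : (0 <= r y)%R by rewrite le_min; apply/andP; split; [exact: fine_ge0 | exact: ler0n].
have r_le y : (r y)%:E <= r0 y by rewrite -(fineK (r0_fin y)) lee_fin ge_min lexx.
exists r; split=> // [y|B mB]; first by rewrite r_ge0 ge_min lexx orbT.
have mrB D : measurable_fun D (fun y => (r y)%:E).
  by apply/measurable_EFinP; exact: measurable_funTS.
pose E := [set y | n%:R%:E < r0 y].
have mE : measurable E.
  by rewrite -[E]setTI; exact: emeasurable_fun_o_infty.
apply/eqP; rewrite eq_le; apply/andP; split; last first.
  rewrite r0E //; apply: ge0_le_integral => //; last exact: measurable_funTS.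
  by move=> y _; rewrite lee_fin.
have mBE : measurable (B `&` E) by exact: measurableI.
have mBD : measurable (B `\` E) by exact: measurableD.
have BU : B = (B `&` E) `|` (B `\` E) by rewrite setUIDK.
have BI : [disjoint B `&` E & B `\` E].
  apply/disj_setPS => y [[_ Ey] [_ nEy]]; exact: nEy.
rewrite BU measureU //; last by rewrite setIACA setICr setI0.
rewrite [leRHS]ge0_integral_setU //; last first.
  by move=> y _; rewrite lee_fin.
apply: leeD.
  apply: le_trans (out_le mBE) _.
  rewrite -integral_cst //; apply: ge0_le_integral => //.
    by move=> y _; rewrite lee_fin.
  by move=> y [_ Ey]; rewrite lee_fin /r min_r // -lee_fin fineK // ltW.
rewrite [leLHS](r0E _ mBD); apply: ge0_le_integral => //.
- exact: measurable_funTS.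
move=> y [_ /negP]; rewrite -leNgt => ny.
by rewrite /r min_l ?fineK // -lee_fin fineK.
Qed.

(* Convexity of [Psi] replaces [n] by the density [r] of the output law; [e] truncates
   the logarithm from below, which makes the function put into [variational]
   nonnegative. *)
Lemma Psi_pointwise (e F r : R) : (0 < e <= 1)%R -> (0 <= F)%R -> (0 <= r <= n%:R)%R ->
  let g := (if r == 0 then expR F else F / r)%R in
  (n%:R * Psi (F / n%:R) - F * ln e <= F * (ln (Num.max g e) - ln e) + r / 2)%R.
Proof.
move=> e01 F0 /andP[r0 rn] /=; have /andP[e0 e1] := e01.
have n0' : (0 < n%:R :> R)%R by rewrite ltr0n.
have n1 : (1 <= n%:R :> R)%R by rewrite ler1n.
rewrite mulrBr; suff : (n%:R * Psi (F / n%:R) <=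
    F * ln (Num.max (if r == 0 then expR F else F / r) e) + r / 2)%R by lra.
(* The product law puts no mass where [r] vanishes, so [g] is free there; the value [expR F] makes
   its logarithm at least [F], and [F ^ 2] dominates [Psi F]. *)
case: eqVneq => [->|rN0].
  have h1 : (n%:R * Psi (F / n%:R) <= Psi F)%R.
    have := @Psi_scale _ n%:R^-1 F; rewrite invr_ge0 (ltW n0') invf_le1 // n1.
    move=> /(_ isT F0) /(ler_wpM2l (ltW n0')).
    by rewrite mulrA mulfV ?gt_eqF // mul1r (mulrC _ F).
  have h2 : (F <= ln (Num.max (expR F) e))%R.
    by rewrite -[leLHS]expRK ler_ln ?posrE ?expR_gt0 ?lt_max ?expR_gt0 // le_max lexx.
  rewrite mul0r addr0; apply: le_trans h1 _; apply: le_trans (Psi_le_square F0) _.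
  by rewrite expr2 ler_wpM2l.
have r00 : (0 < r)%R by rewrite lt_neqAle eq_sym rN0.
have g0 : (0 <= F / r)%R by rewrite divr_ge0.
have := @Psi_scale _ (r / n%:R) (F / r).
rewrite divr_ge0 ?(ltW n0') // ler_pdivrMr // mul1r rn => /(_ isT g0).
have -> : (r / n%:R * (F / r) = F / n%:R)%R by field; rewrite !gt_eqF.
move=> /(ler_wpM2l (ltW n0')) => h; apply: le_trans h _.
have -> : (n%:R * (r / n%:R * Psi (F / r)) = r * Psi (F / r))%R.
  by field; rewrite gt_eqF.
have := ler_wpM2l r0 (Psi_le_ln e01 g0).
by rewrite mulrDr mulrA (mulrCA r) mulfV ?gt_eqF // mulr1.
Qed.

(** Relative to the product law the joint law has density [f / r], so the optimal test function is
    [ln (f / r)]; [k] is its truncated and shifted version, and duality bounds its expectation by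
    [I * ln 2] up to the truncation error. *)
Lemma integral_Psi_le :
  \int[mu \x rho]_p (n%:R * Psi (f p / n%:R))%:E <= (I * ln 2 + 16^-1 + 2^-1)%:E.
Proof.
have [r [mr rB rE]] := output_density.
(* Truncation at [e] raises the exponential moment from 1 to at most [1 + e]. The shift [s = - ln e]
   that makes [k] nonnegative cancels at the end, because [f] integrates to 1. *)
pose e : R := (16^-1)%R; have e01 : (0 < e <= 1)%R by rewrite /e; lra.
have /andP[e0 e1] := e01.
pose s := (- ln e)%R; have s0 : (0 <= s)%R by rewrite oppr_ge0 ln_le0.
pose g (p : X * Y) := (if r p.2 == 0 then expR (f p) else f p / r p.2)%R.
pose k p := (ln (Num.max (g p) e) - ln e)%R.
have mr2 : measurable_fun setT (fun p : X * Y => r p.2).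
  exact: (measurableT_comp mr measurable_snd).
have r0 y : (0 <= r y)%R by have /andP[] := rB y.
have mg : measurable_fun setT g.
  apply: measurable_fun_ifT; first exact: measurable_fun_eqr.
    exact: measurableT_comp.
  rewrite (_ : (fun p => _) = (fun p => f p * (r p.2) `^ (-1))%R).
    by apply: measurable_funM => //; exact: (measurableT_comp (@measurable_powR R (-1)%R) mr2).
  by apply/funext => p; rewrite powR_inv1.
have mk : measurable_fun setT k.
  apply: measurable_funB => //; apply: (measurableT_comp (@measurable_ln R)).
  exact: measurable_maxr.
have k0 p : (0 <= k p)%R.
  by rewrite /k subr_ge0 ler_ln ?posrE ?lt_max ?e0 ?orbT // le_max lexx orbT.
have fr := fun p => Psi_pointwise e01 (f0 p) (rB p.2).
have mnPsi : measurable_fun setT (fun p => n%:R * Psi (f p / n%:R))%R.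
  apply: measurable_funM => //; apply: (measurableT_comp measurable_Psi).
  exact: measurable_funM.
have fT : \int[mu \x rho]_p (f p)%:E = 1.
  by rewrite -fE // [LHS]probability_setT.
have rT : \int[rho]_y (r y)%:E = 1.
  by rewrite -rE // [LHS]probability_setT.
have mrE : measurable_fun setT (fun y => (r y)%:E) by exact/measurable_EFinP.
have r2T : \int[mu \x rho]_p (r p.2 / 2)%:E = (2^-1)%:E.
  rewrite (fubini_tonelli1 (fun p => (r p.2 / 2)%:E)) //; last 2 first.
  - by apply/measurable_EFinP; exact: measurable_funM.
  - by move=> p; rewrite lee_fin divr_ge0.
  rewrite (eq_integral (cst (2^-1)%:E)).
    by rewrite integral_cst //= probability_setT mule1.
  move=> x _; rewrite /fubini_F /=; under eq_integral do rewrite EFinM.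
  by rewrite ge0_integralZr ?rT ?mul1e // => y _; rewrite lee_fin.
have Jk : \int[joint mu Q]_p (k p)%:E = \int[mu \x rho]_p (f p * k p)%:E.
  rewrite (integral_density mf f0 fE); first by apply: eq_integral => p _; rewrite -EFinM mulrC.
    exact/measurable_EFinP.
  by move=> p; rewrite lee_fin.
have main : \int[mu \x rho]_p (n%:R * Psi (f p / n%:R))%:E + s%:E <=
    \int[joint mu Q]_p (k p)%:E + (2^-1)%:E.
  rewrite Jk -r2T -[s%:E]mule1 -fT -ge0_integralZl_EFin //; last exact/measurable_EFinP.
    rewrite -!ge0_integralD //.
    + apply: ge0_le_integral => //.
      * by move=> p _; rewrite -EFinM -EFinD lee_fin addr_ge0 ?mulr_ge0 ?Psi_ge0.
      * apply: emeasurable_funD; first exact/measurable_EFinP.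
        by apply/measurable_EFinP; exact: measurable_funM.
      * apply: emeasurable_funD; apply/measurable_EFinP; exact: measurable_funM.
      * move=> p _; rewrite -EFinM -!EFinD lee_fin; have := fr p.
        rewrite /k /s; lra.
    + by move=> p _; rewrite lee_fin mulr_ge0.
    + by apply/measurable_EFinP; exact: measurable_funM.
    + by move=> p _; rewrite lee_fin divr_ge0.
    + by apply/measurable_EFinP; exact: measurable_funM.
    + by move=> p _; rewrite lee_fin mulr_ge0 ?Psi_ge0.
    + exact/measurable_EFinP.
    + by move=> p _; rewrite -EFinM lee_fin mulr_ge0.
    + by apply/measurable_EFinP; exact: measurable_funM.
  by move=> p _; rewrite lee_fin.
have piE C : measurable C -> product_law mu Q C = \int[mu \x rho]_(p in C) (r p.2)%:E.
  move=> mC; rewrite integral_product_xsection //.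
  - by apply: eq_integral => x _; exact: rE _ (measurable_xsection _ mC).
  - exact/measurable_EFinP.
  - by move=> p; rewrite lee_fin.
have piexp : \int[product_law mu Q]_p (expR (k p - s))%:E <= (1 + e)%:E.
  have gE p : (expR (k p - s) = Num.max (g p) e)%R.
    by rewrite /k /s opprK subrK lnK // posrE lt_max e0 orbT.
  have g_ge0 p : (0 <= g p)%R.
    by rewrite /g; case: ifP => _; rewrite ?expR_ge0 ?divr_ge0.
  under eq_integral do rewrite gE.
  rewrite (integral_density mr2 (fun p => r0 p.2) piE); last 2 first.
  - by apply/measurable_EFinP; exact: measurable_maxr.
  - by move=> p; rewrite lee_fin le_max g_ge0.
  apply: (@le_trans _ _ (\int[mu \x rho]_p ((f p)%:E + e%:E * (r p.2)%:E))).
    apply: ge0_le_integral => //.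
    - by move=> p _; rewrite -EFinM lee_fin mulr_ge0 // le_max g_ge0.
    - apply: emeasurable_funM; apply/measurable_EFinP => //; exact: measurable_maxr.
    - apply: emeasurable_funD; first exact/measurable_EFinP.
      apply: emeasurable_funM => //; exact/measurable_EFinP.
    - move=> p _; rewrite -!EFinM -EFinD lee_fin.
      have : (Num.max (g p) e <= g p + e)%R.
        by rewrite ge_max lerDl lerDr (ltW e0) g_ge0.
      move=> /(ler_wpM2r (r0 p.2)); rewrite mulrDl => /le_trans; apply.
      rewrite lerD2r /g; case: eqVneq => [->|rN0]; first by rewrite mulr0.
      by rewrite divfK.
  rewrite ge0_integralD //; last 4 first.
  - by move=> p _; rewrite lee_fin.
  - exact/measurable_EFinP.
  - by move=> p _; rewrite -EFinM lee_fin mulr_ge0 // ltW.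
  - by apply: emeasurable_funM => //; exact/measurable_EFinP.
  rewrite fT ge0_integralZl_EFin //; last 3 first.
  - by move=> p _; rewrite lee_fin.
  - exact/measurable_EFinP.
  - exact: ltW.
  by rewrite -piE // [X in _ + _ * X]probability_setT mule1.
have := variational IE s mk k0; move: main piexp.
set A := \int[mu \x rho]_p _; set B := \int[joint mu Q]_p _; set D := \int[product_law mu Q]_p _.
have A0 : 0 <= A by apply: integral_ge0 => p _; rewrite lee_fin mulr_ge0 ?Psi_ge0.
have B0 : 0 <= B by apply: integral_ge0 => p _; rewrite lee_fin.
have D0 : 0 <= D by apply: integral_ge0 => p _; rewrite lee_fin expR_ge0.
move=> h1 h2 h3.
have {h2 h3}: B + 1 <= (I * ln 2 + s + (1 + e))%:E.
  by apply: le_trans h3 _; rewrite (EFinD (I * ln 2 + s)); apply: leeD2l.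
move=> h2.
have -> : (I * ln 2 + 16^-1 + 2^-1 = I * ln 2 + s + (1 + e) + 2^-1 - 1 - s)%R.
  by rewrite /e; lra.
exact: (le_of_shifted_sums A0 B0 h1 h2).
Qed.

End cost_bound.

(** * A common density for finitely many input laws *)

Section average.
Context {R : realType} {d : measure_display} {X : measurableType d}.
Variables (mu : nat -> probability X R) (n : nat).
Local Open Scope ereal_scope.

Let weight_ge0 : (0 <= n.+1%:R^-1 :> R)%R.
Proof. by rewrite invr_ge0. Qed.

Let total : {measure set X -> \bar R} := msum mu n.+1.
Let scaled : {measure set X -> \bar R} := mscale (NngNum weight_ge0) total.

Let scaledT : scaled setT = 1.
Proof.
rewrite /scaled /= /mscale /= /total /= /msum.
rewrite (eq_bigr (fun=> 1%:E)); last by move=> k _; exact: probability_setT.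
by rewrite sumEFin -EFinM sumr_const card_ord mulVf // pnatr_eq0.
Qed.

Definition average : probability X R := mprob scaledT.

Lemma integral_average (h : X -> \bar R) : measurable_fun setT h -> (forall x, 0 <= h x) ->
  \int[average]_x h x = (n.+1%:R^-1)%:E * \sum_(k < n.+1) \int[mu k]_x h x.
Proof.
move=> mh h0; transitivity (\int[scaled]_x h x); first by [].
by rewrite ge0_integral_mscale // ge0_integral_measure_sum.
Qed.

(** Each law is one of [n.+1] equal shares of the average; the factor in the logarithm of the final
    bound originates here. *)
Lemma integral_le_average k (h : X -> \bar R) : (k < n.+1)%N ->
  measurable_fun setT h -> (forall x, 0 <= h x) ->
  \int[mu k]_x h x <= n.+1%:R%:E * \int[average]_x h x.
Proof.
move=> kn mh h0; rewrite integral_average // muleA -EFinM mulfV ?pnatr_eq0 // mul1e.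
rewrite (bigD1 (Ordinal kn)) //= leeDl // sume_ge0 // => i _.
exact: integral_ge0.
Qed.

Lemma average_null_integral k (h : X -> \bar R) : (k < n.+1)%N ->
  measurable_fun setT h -> (forall x, 0 <= h x) ->
  \int[average]_x h x = 0 -> \int[mu k]_x h x = 0.
Proof.
move=> kn mh h0 hI; apply/eqP; rewrite eq_le integral_ge0 // andbT.
by apply: le_trans (integral_le_average kn mh h0) _; rewrite hI mule0.
Qed.

Lemma average_ae k (P : set X) : (k < n.+1)%N ->
  {ae average, forall x, P x} -> {ae mu k, forall x, P x}.
Proof.
move=> kn [A [mA A0 PA]]; exists A; split=> //.
have := @average_null_integral k (EFin \o \1_A) kn.
rewrite !integral_indic // !setIT; apply.
- by apply/measurable_EFinP; exact: measurable_indic.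
- by move=> x; rewrite lee_fin.
- exact: A0.
Qed.

End average.

Section common_density.
Context {R : realType} {dX dY : measure_display} {X : measurableType dX}
  {Y : measurableType dY}.
Variables (mu : nat -> probability X R) (Q : R.-pker X ~> Y) (n : nat) (I : nat -> R).
Hypothesis IE : forall k, mutual_info (mu k) Q = (I k)%:E.
Local Open Scope ereal_scope.

Local Notation avg := (average mu n).
Definition reference : probability Y R := output avg Q.
Local Notation rho := reference.

Lemma output_le_reference k B : (k < n.+1)%N -> measurable B ->
  output (mu k) Q B <= n.+1%:R%:E * rho B.
Proof.
move=> kn mB; apply: integral_le_average => //; exact: measurable_kernel.
Qed.

(** For each [k], the output law is at most a multiple of [rho] and the input law at most a multiple
    of the average, so [C] is null for the [k]th product law; finite mutual information then makes
    it null for the [k]th joint law. *)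
Lemma joint_average_dominated C : measurable C ->
  (avg \x rho) C = 0 -> joint avg Q C = 0.
Proof.
move=> mC C0; rewrite jointE /joint_law integral_average //; last exact: measurable_kernel_xsection.
rewrite big1 ?mule0 // => k _; have kn := ltn_ord k.
apply: (joint_dominated (IE k) mC); apply/eqP; rewrite eq_le measure_ge0 andbT.
have mrho : measurable_fun setT (fun x => rho (xsection C x)).
  exact: measurable_fun_xsection.
apply: (@le_trans _ _ (\int[mu k]_x (n.+1%:R%:E * rho (xsection C x)))).
  apply: ge0_le_integral => //.
  - exact: measurable_fun_xsection.
  - exact: emeasurable_funM.
  - by move=> x _; apply: output_le_reference => //; exact: measurable_xsection.
rewrite ge0_integralZl_EFin // (average_null_integral kn mrho) ?mule0 //.
Qed.

Lemma exists_average_density : exists F : X * Y -> R,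
  [/\ measurable_fun setT F, forall p, (0 <= F p)%R &
   forall C, measurable C ->
     joint avg Q C = \int[avg]_x \int[rho]_(y in xsection C x) (F (x, y))%:E].
Proof.
have dom : joint avg Q `<< avg \x rho.
  by apply/null_content_dominatesP => C mC C0; exact: joint_average_dominated.
have [F0 [F0_ge0 F0_fin F0_int F0E]] :=
  @radon_nikodym_sigma_finite _ _ _ (product_law avg Q) (joint avg Q) dom.
have mF0 := measurable_int _ F0_int.
exists (fine \o F0); split => [|p|C mC]; [exact: (measurableT_comp _ mF0)|exact: fine_ge0|].
rewrite F0E // [LHS]integral_product_xsection //.
by apply: eq_integral => x _; apply: eq_integral => y _; rewrite /= fineK.
Qed.

Lemma measurable_integral_xsection (F : X * Y -> R) C : measurable C ->
  measurable_fun setT F -> (forall p, (0 <= F p)%R) ->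
  measurable_fun setT (fun x => \int[rho]_(y in xsection C x) (F (x, y))%:E).
Proof.
move=> mC mF F0; pose h : X * Y -> \bar R := (EFin \o F) \_ C.
have mh : measurable_fun setT h.
  by apply/(measurable_restrictT _ mC); apply: measurable_funTS; exact/measurable_EFinP.
have h0 p : 0 <= h p by rewrite /h patchE; case: ifP => // _; rewrite lee_fin.
have := measurable_fun_fubini_tonelli_F (m2 := rho) h mh h0.
apply: eq_measurable_fun => x _; rewrite /fubini_F [RHS]integral_mkcond.
by apply: eq_integral => y _; rewrite /h !patchE mem_xsection.
Qed.

Lemma density_ae (F : X * Y -> R) :
  measurable_fun setT F -> (forall p, (0 <= F p)%R) ->
  (forall C, measurable C ->
     joint avg Q C = \int[avg]_x \int[rho]_(y in xsection C x) (F (x, y))%:E) ->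
  forall C, measurable C ->
    {ae avg, forall x, Q x (xsection C x) = \int[rho]_(y in xsection C x) (F (x, y))%:E}.
Proof.
move=> mF F0 FE C mC.
have mQ := measurable_kernel_xsection Q mC.
have intQ : avg.-integrable setT (fun x => Q x (xsection C x)).
  apply/integrableP; split=> //.
  under eq_integral do rewrite gee0_abs //.
  apply: le_lt_trans (ltry 1); rewrite -[leRHS](probability_setT (joint avg Q)).
  by apply: le_measure; rewrite ?inE.
have mI := measurable_integral_xsection mC mF F0.
have := integral_ae_eq measurableT intQ mI.
have E_eq E : (E `<=` setT) -> measurable E -> \int[avg]_(x in E) Q x (xsection C x) =
    \int[avg]_(x in E) \int[rho]_(y in xsection C x) (F (x, y))%:E.
  (* Integrating over [x] in [E] amounts to cutting [C] by the strip [E * Y], to which the density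
     formula applies. *)
  move=> _ mE; have mCE : measurable (C `&` (E `*` setT)).
    by apply: measurableI => //; exact: measurableX.
  have xs x : xsection (C `&` (E `*` setT)) x = if x \in E then xsection C x else set0.
    apply/seteqP; split=> y; rewrite /xsection /=; case: ifPn => xE.
    - by move=> /set_mem[Cxy _]; exact: mem_set.
    - by move=> /set_mem[_ [/= Ex _]]; move: xE; rewrite notin_setE.
    - by move=> /set_mem Cxy; apply: mem_set; split=> //; split => //; exact: set_mem.
    - by [].
  have := FE _ mCE; rewrite jointE /joint_law => h.
  rewrite integral_mkcond [RHS]integral_mkcond.
  rewrite (eq_integral (fun x => Q x (xsection (C `&` (E `*` setT)) x))); last first.
    by move=> x _; rewrite patchE xs; case: ifP => // _; rewrite measure0.
  rewrite h; apply: eq_integral => x _; rewrite patchE xs; case: ifP => // _.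
  by rewrite integral_set0.
move=> /(_ E_eq); apply: filterS => x; exact.
Qed.

(** One density serves all input laws because a set null for the average is null for each of them.
    The exceptional set of [density_ae] depends on [C], which is harmless in a conclusion integrated
    over [x]. *)
Lemma exists_common_density : exists f : X * Y -> R,
  [/\ measurable_fun setT f, forall p, (0 <= f p)%R,
   forall x, \int[rho]_y (f (x, y))%:E = 1 &
   forall k C, (k < n.+1)%N -> measurable C ->
     joint (mu k) Q C = \int[mu k]_x \int[rho]_(y in xsection C x) (f (x, y))%:E].
Proof.
have [F [mF F0 FE]] := exists_average_density.
pose tot x := \int[rho]_y (F (x, y))%:E.
have xsT x : xsection setT x = [set: Y] by rewrite xsectionE preimage_setT.
have mtot : measurable_fun setT tot.
  have := measurable_integral_xsection measurableT mF F0.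
  by under eq_fun do rewrite xsT.
pose good := [set x | tot x = 1].
have mgood : measurable good.
  by rewrite -[good]setTI; exact: (mtot measurableT [set 1] (emeasurable_set1 1)).
(* Off the full set [good], [F (x, _)] is not a density and is replaced by 1. *)
pose f p := (\1_good p.1 * F p + \1_(~` good) p.1)%R.
have f0 p : (0 <= f p)%R by rewrite addr_ge0 ?mulr_ge0.
have mind (A : set X) : measurable A -> measurable_fun setT (fun p : X * Y => \1_A p.1 : R).
  move=> mA; apply: (measurableT_comp _ measurable_fst); exact: measurable_indic.
have mf : measurable_fun setT f.
  apply: measurable_funD; last by apply: mind; exact: measurableC.
  by apply: measurable_funM => //; exact: mind.
have fgood x y : good x -> f (x, y) = F (x, y).
  by move=> gx; rewrite /f /= !indicE in_setC mem_set //= mul1r addr0.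
exists f; split=> //.
  move=> x; have [gx|gx] := pselect (good x).
    by under eq_integral => y _ do rewrite fgood //.
  rewrite (eq_integral (cst 1)); first by rewrite integral_cst // mul1e [LHS]probability_setT.
  by move=> y _; rewrite /f /= !indicE in_setC memNset //= mul0r add0r.
move=> k C kn mC; rewrite jointE /joint_law; apply: ge0_ae_eq_integral => //.
- exact: measurable_kernel_xsection.
- exact: measurable_integral_xsection.
- by move=> x _; apply: integral_ge0 => y _; rewrite lee_fin.
have ae1 := average_ae kn (density_ae mF F0 FE mC).
have ae2 := average_ae kn (density_ae mF F0 FE measurableT).
apply: filterS2 ae1 ae2 => x.
rewrite xsT prob_kernel => -> /esym gx _.
by apply: eq_integral => y _; rewrite fgood.
Qed.

End common_density.

(** * Entropy of a variable determined by an index *)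

Section index_entropy.
Context {R : realType} {dX dY : measure_display} {X : measurableType dX}
  {Y : measurableType dY}.
Variables (m : probability X R) (G : X -> Y) (D : nat -> set X) (v : nat -> Y).
Variables (w : nat -> R) (cost : X -> \bar R).
Hypothesis mG : measurable_fun setT G.
Hypothesis mY1 : forall y : Y, measurable [set y].
Hypothesis mD : forall i, measurable (D i).
Hypothesis tD : trivIset setT D.
Hypothesis GD : forall i x, D i x -> G x = v i.
Hypothesis w0 : forall i, (0 < w i)%R.
Local Open Scope ereal_scope.
Hypothesis w1 : \sum_(i <oo) (w i)%:E <= 1.
Hypothesis mcost : measurable_fun setT cost.
Hypothesis costD : forall i x, D i x -> cost x = (- log2 (w i))%:E.
Hypothesis costN : forall x, ~ (\bigcup_i D i) x -> cost x = +oo.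

Local Notation N := (~` \bigcup_i D i).
Local Notation nu := (pushforward m G).
Local Notation mass y := (m (G @^-1` [set y])).

Let mfib y : measurable (G @^-1` [set y]).
Proof. by rewrite -[X in measurable X]setTI; exact: mG. Qed.

Let mUD : measurable (\bigcup_i D i).
Proof. exact: bigcupT_measurable. Qed.

Let w_le1 i : (w i <= 1)%R.
Proof.
rewrite -lee_fin; apply: le_trans w1.
apply: le_trans (nneseries_lim_ge i.+1 _); last by move=> j _ _; rewrite lee_fin ltW.
rewrite big_nat_recr //=; apply: leeDr.
by apply: sume_ge0 => j _; rewrite lee_fin ltW.
Qed.

Let c0 i : (0 <= - log2 (w i))%R.
Proof. by rewrite oppr_ge0 /log2 pmulr_lle0 ?invr_gt0 ?ln2_gt0 // ln_le0 ?w_le1. Qed.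

Let cost0 x : 0 <= cost x.
Proof.
have [[i _ Dx]|/costN ->//] := pselect ((\bigcup_i D i) x).
by rewrite (costD Dx) lee_fin c0.
Qed.

Lemma cost_null : \int[m]_x cost x < +oo -> m N = 0.
Proof.
move=> fin; apply/eqP; rewrite eq_le measure_ge0 andbT leNgt; apply/negP => N0.
have mN : measurable N by exact: measurableC.
move: fin; suff -> : \int[m]_x cost x = +oo by rewrite ltxx.
apply/eqP; rewrite -leye_eq -(gt0_mulye N0) -integral_cst //.
rewrite (eq_integral (fun x => cost x)).
  by apply: ge0_subset_integral => // x _; exact: cost0.
by move=> x; rewrite inE => /costN ->.
Qed.

Section negligible_complement.
Hypothesis N0 : m N = 0.

Lemma mass_split A : measurable A -> m A = \sum_(i <oo) m (A `&` D i).
Proof.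
move=> mA; have mAD i : measurable (A `&` D i) by exact: measurableI.
rewrite (measureDI m mA mUD) (subset_measure0 _ _ _ N0); last 3 first.
- exact: measurableD.
- exact: measurableC.
- by move=> x [].
rewrite add0e setI_bigcupr; apply: measure_semi_bigcup => //.
  exact: trivIset_setIl.
exact: bigcupT_measurable.
Qed.

Lemma sum_massD : \sum_(i <oo) m (D i) = 1.
Proof.
rewrite -(probability_setT m) (mass_split measurableT).
by apply: eq_eseriesr => i _; rewrite setTI.
Qed.

Lemma fiberD y i : m (G @^-1` [set y] `&` D i) = if v i == y then m (D i) else 0.
Proof.
case: eqVneq => [vy|/eqP vy].
  by congr (m _); apply/setIidPr => x /GD /= ->.
rewrite (_ : _ `&` _ = set0) ?measure0 // -subset0 => x [/= Gy /GD Gx].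
by apply: vy; rewrite -Gx.
Qed.

Lemma mass_fiber y : mass y = \sum_(i <oo) if v i == y then m (D i) else 0.
Proof. by rewrite mass_split //; apply: eq_eseriesr => i _; rewrite fiberD. Qed.

(** Up to a null set the output takes one of the countably many values [v i], so its law is purely
    atomic and [entropy] is given by the sum rather than by its default [+oo]. *)
Lemma esum_atoms : \esum_(y in atoms nu) nu [set y] = 1.
Proof.
apply/eqP; rewrite eq_le; apply/andP; split.
  apply: ge_ereal_sup => _ [F [finF _] <-].
  rewrite /pushforward -(measure_fsbig _ finF); last 2 first.
  - by [].
  - by apply/trivIsetP => y1 y2 _ _ /eqP y12; rewrite -subset0 => x [/= -> /y12].
  apply: probability_le1; rewrite fsbig_setU //; apply: fin_bigcup_measurable => //.
rewrite -sum_massD; apply: lime_le; first by apply: is_cvg_nneseries.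
apply: nearW => k; pose F := atoms nu `&` v @` `I_k.
have finF : finite_set F by apply: finite_setIr; apply: finite_image; exact: finite_II.
apply: esum_ge; exists F; first by split=> // y [].
rewrite fsbig_finite //= /pushforward.
apply: (@le_trans _ _ (\sum_(0 <= i < k) \sum_(y <- finmap.enum_fset (fset_set F))
    m (G @^-1` [set y] `&` D i))).
  rewrite big_nat [leRHS]big_nat; apply: lee_sum => i /andP[_ ik].
  have [D0|D0] := eqVneq (m (D i)) 0; first by rewrite D0 sume_ge0.
  have mDv : m (G @^-1` [set v i] `&` D i) = m (D i) by rewrite fiberD eqxx.
  have viF : v i \in finmap.enum_fset (fset_set F).
    rewrite in_fset_set // inE; split; last by exists i.
    rewrite /atoms /pushforward /=; apply: lt_le_trans (measureIl m (mfib _) (mD i)).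
    rewrite lt_neqAle measure_ge0 andbT eq_sym; apply: contra D0 => /eqP h.
    by apply/eqP; exact: etrans (esym mDv) h.
  rewrite (bigD1_seq (v i)) ?finmap.fset_uniq //=.
  apply: (@le_trans _ _ (m (G @^-1` [set v i] `&` D i))).
    by rewrite le_eqVlt; apply/orP; left; apply/eqP; exact: esym mDv.
  by rewrite leeDl // sume_ge0.
rewrite exchange_big /=; apply: lee_sum => y _.
by rewrite (mass_split (mfib y)); exact: nneseries_lim_ge.
Qed.

(* Gibbs' inequality for one atom, whose mass and weight collect those of all
   indices with value [y]; the linear terms cancel in the sum over the atoms. *)
Lemma atom_cost y : 0 < mass y ->
  (- (fine (mass y) * log2 (fine (mass y))))%:E + (fine (mass y) / ln 2)%:E <=
  \sum_(i <oo) if v i == y then (fine (m (D i)) * (- log2 (w i)) + w i / ln 2)%:E else 0.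
Proof.
have mfin A : measurable A -> m A \is a fin_num by exact: fin_num_measure.
set p := fine (mass y) => y_gt0.
have p0 : (0 < p)%R by rewrite -lte_fin fineK ?mfin.
pose q := \sum_(i <oo) if v i == y then (w i)%:E else 0.
have w_ge0 i : 0 <= if v i == y then (w i)%:E else 0.
  by case: ifP => // _; rewrite lee_fin ltW.
have q1 : q <= 1.
  apply: le_trans w1; apply: lee_nneseries => // i _; case: ifP => // _.
  by rewrite lee_fin ltW.
have qfin : q \is a fin_num.
  by rewrite ge0_fin_numE ?(le_lt_trans q1) ?ltry // nneseries_ge0.
have wq i : v i = y -> (w i <= fine q)%R.
  move=> vy; rewrite -lee_fin fineK //.
  apply: le_trans (nneseries_lim_ge i.+1 _); last by move=> j _ _; exact: w_ge0.
  by rewrite big_nat_recr //= vy eqxx leeDr // sume_ge0.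
have [i0 vi0] : exists i, v i = y.
  apply: contrapT => /forallNP nv; move: y_gt0.
  rewrite mass_fiber eseries0 ?ltxx // => i _ _.
  by case: eqP => // /nv.
have q0 : (0 < fine q)%R by apply: lt_le_trans (wq _ vi0).
have key : (- (p * log2 p) + p / ln 2 <= p * (- log2 (fine q)) + fine q / ln 2)%R.
  rewrite /log2.
  have := ler_wpM2l (ltW p0) (@ln_ge1BV _ (p / fine q)%R _).
  rewrite divr_gt0 // invf_div ln_div ?posrE // => /(_ isT).
  have -> : (p * (1 - fine q / p) = p - fine q)%R by field; rewrite gt_eqF.
  move=> h; rewrite -subr_ge0.
  have -> : (p * - (ln (fine q) / ln 2) + fine q / ln 2 - (- (p * (ln p / ln 2)) + p / ln 2)
    = (p * (ln p - ln (fine q)) - (p - fine q)) / ln 2)%R by field; rewrite gt_eqF ?ln2_gt0.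
  by rewrite divr_ge0 ?subr_ge0 // ltW // ln2_gt0.
rewrite -EFinD; apply: (@le_trans _ _ (p * (- log2 (fine q)) + fine q / ln 2)%:E).
  by rewrite lee_fin.
have lq0 : (0 <= - log2 (fine q))%R.
  by rewrite oppr_ge0 /log2 pmulr_lle0 ?invr_gt0 ?ln2_gt0 // ln_le0 // -lee_fin fineK.
have l20 : (0 <= (ln 2)^-1 :> R)%R by rewrite invr_ge0 ltW // ln2_gt0.
rewrite (mulrC p) (mulrC (fine q)) EFinD !EFinM !fineK ?mfin // mass_fiber /q.
rewrite -!nneseriesZl //; last by move=> i _; case: ifP.
rewrite -nneseriesD; last 2 first.
- by move=> i _ _; rewrite mule_ge0 //; case: ifP.
- by move=> i _ _; rewrite mule_ge0.
apply: lee_nneseries => [i _ _|i _].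
  by rewrite adde_ge0 // mule_ge0 //; case: ifP.
case: eqP => [vy|_]; last by rewrite !mule0 adde0.
rewrite -(fineK (mfin _ (mD i))) -!EFinM -EFinD lee_fin (mulrC _^-1%R) lerD2r mulrC.
(* Each weight with value [y] is at most their sum [q], so the cost of [q] is at most that of any
   single index and the mass can be charged index by index. *)
rewrite ler_wpM2l ?fine_ge0 // lerN2 /log2 ler_wpM2r // ler_ln ?posrE //; exact: wq.
Qed.

Lemma le_integral_cost : \sum_(i <oo) (fine (m (D i)) * (- log2 (w i)))%:E <= \int[m]_x cost x.
Proof.
apply: (@le_trans _ _ (\int[m]_(x in \bigcup_i D i) cost x)); last first.
  by apply: ge0_subset_integral.
rewrite ge0_integral_bigcup //; last exact: measurable_funTS.
apply: lee_nneseries => [i _ _|i _]; first by rewrite lee_fin mulr_ge0 ?fine_ge0.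
rewrite (eq_integral (cst (- log2 (w i))%:E)); last first.
  by move=> x; rewrite inE => /costD.
by rewrite integral_cst // EFinM fineK ?fin_num_measure // muleC.
Qed.

Let sum_t : \sum_(i <oo) (fine (m (D i)) * (- log2 (w i)) + w i / ln 2)%:E <=
  \int[m]_x cost x + ((ln 2)^-1)%:E.
Proof.
have l20 : (0 <= (ln 2)^-1 :> R)%R by rewrite invr_ge0 ltW // ln2_gt0.
under eq_eseriesr do rewrite EFinD.
rewrite nneseriesD; last 2 first.
- by move=> i _ _; rewrite lee_fin mulr_ge0 ?fine_ge0.
- by move=> i _ _; rewrite lee_fin mulr_ge0 // ltW.
apply: leeD; first exact: le_integral_cost.
under eq_eseriesr do rewrite mulrC EFinM.
rewrite nneseriesZl; last by move=> i _; rewrite lee_fin ltW.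
by rewrite -[leRHS]mule1 lee_wpmul2l.
Qed.

Lemma entropy_le_null : entropy nu <= \int[m]_x cost x.
Proof.
have l20 : (0 <= (ln 2)^-1 :> R)%R by rewrite invr_ge0 ltW // ln2_gt0.
have mass_le1 y : (fine (mass y) <= 1)%R.
  by rewrite -lee_fin fineK ?fin_num_measure // probability_le1.
have cost_y y : (0 <= - (fine (mass y) * log2 (fine (mass y))))%R.
  rewrite -mulrN mulr_ge0 ?fine_ge0 // oppr_ge0 /log2 pmulr_lle0 ?invr_gt0 ?ln2_gt0 //.
  by rewrite ln_le0.
rewrite /entropy esum_atoms eqxx.
(* The same constant is added on both sides: on the left it is the total mass of the atoms over
   [ln 2], on the right it bounds the total weight over [ln 2]. *)
suff : \esum_(y in atoms nu) (- (fine (nu [set y]) * log2 (fine (nu [set y]))))%:E +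
    ((ln 2)^-1)%:E <= \int[m]_x cost x + ((ln 2)^-1)%:E by rewrite leeD2rE.
apply: (@le_trans _ _ (\esum_(y in atoms nu) (- (fine (nu [set y]) * log2 (fine (nu [set y]))))%:E +
    \esum_(y in atoms nu) (fine (nu [set y]) / ln 2)%:E)).
  apply: leeD2l; rewrite -[leLHS]mule1 lee_pdivrMl ?ln2_gt0 // -esum_atoms.
  apply: ge_ereal_sup => _ [F [finF atF] <-].
  rewrite -lee_pdivrMl ?ln2_gt0 //; apply: esum_ge; exists F => //.
  rewrite !fsbig_finite // /pushforward ge0_sume_distrr; last by move=> y _; exact: measure_ge0.
  apply: lee_sum => y _.
  by rewrite mulrC EFinM fineK // fin_num_measure.
rewrite -esumD; last 2 first.
- by move=> y _; rewrite lee_fin; exact: cost_y.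
- by move=> y _; rewrite lee_fin mulr_ge0 // fine_ge0 // measure_ge0.
apply: le_trans sum_t.
apply: ge_ereal_sup => _ [F [finF atF] <-].
rewrite fsbig_finite //=.
apply: (@le_trans _ _ (\sum_(y <- finmap.enum_fset (fset_set F)) \sum_(i <oo)
    if v i == y then (fine (m (D i)) * (- log2 (w i)) + w i / ln 2)%:E else 0)).
  rewrite big_seq [leRHS]big_seq; apply: lee_sum => y.
  by rewrite in_fset_set // inE => /atF; exact: atom_cost.
have t0 i : (0 <= fine (m (D i)) * (- log2 (w i)) + w i / ln 2)%R.
  by rewrite addr_ge0 ?mulr_ge0 ?fine_ge0 // ltW.
rewrite -nneseries_sum; last by move=> y i _; case: ifP => _ //; rewrite lee_fin.
apply: lee_nneseries => [i _ _|i _]; first by rewrite sume_ge0 // => y _; case: ifP => _ //; rewrite lee_fin.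
have [viF|viF] := boolP (v i \in finmap.enum_fset (fset_set F)).
  rewrite (bigD1_seq (v i)) ?finmap.fset_uniq //= eqxx big1 ?adde0 // => y.
  by rewrite eq_sym => /negPf ->.
rewrite big1_seq ?lee_fin // => y /= yF; case: eqP => // vy.
by move: viF; rewrite vy yF.
Qed.

End negligible_complement.

(** The infinite cost outside the sets [D i] settles the case split: either the integral is [+oo],
    or the complement is null and Gibbs' inequality applies. *)
Lemma entropy_le_cost : entropy nu <= \int[m]_x cost x.
Proof.
have [/cost_null/entropy_le_null//|] := ltP (\int[m]_x cost x) +oo.
by rewrite leye_eq => /eqP ->; rewrite leey.
Qed.

End index_entropy.

(** * Conditional entropy of the selected value *)

Lemma polish_singleton (R : realType) d (Y : measurableType d) (y : Y) :
  polish_space R Y -> measurable [set y].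
Proof.
move=> [dist [[dist_ge0 dist0 _ _] _ _ mE]]; rewrite -[X in measurable X]setCK.
apply: measurableC; rewrite mE; apply: sub_sigma_algebra => x xy.
exists (dist x y) => [|z xz zy].
  by rewrite lt_neqAle dist_ge0 andbT eq_sym; apply/eqP => /dist0.
by move: xz; rewrite zy ltxx.
Qed.

(** Stated for an arbitrary [f], since it is applied to the entropy of the output given [z], whose
    measurability in [z] is not established. Each simple function below the positive part of [f] is
    also below [h]. *)
Lemma integral_le_majorant (R : realType) d (T : measurableType d)
    (m : {measure set T -> \bar R}) (f h : T -> \bar R) :
  (forall x, f x <= h x)%E -> (forall x, 0 <= h x)%E ->
  (\int[m]_x f x <= \int[m]_x h x)%E.
Proof.
move=> fh h0; rewrite integralE.
apply: (@le_trans _ _ (\int[m]_x f^\+ x)%E).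
  rewrite -[leRHS]adde0; apply: leeD2l; rewrite oppe_le0; exact: integral_ge0.
rewrite !ge0_integralE //; apply: le_ereal_sup => _ [u /= uf <-]; exists u => // x.
apply: le_trans (uf x) _; rewrite !patchE; case: ifP => // _.
by rewrite funeposE ge_max fh h0.
Qed.

(** The trivial partitions contribute the value 0 to the supremum. *)
Lemma mutual_info_ge0 (R : realType) (dX dY : measure_display) (X : measurableType dX)
    (Y : measurableType dY) (mu : probability X R) (Q : R.-pker X ~> Y) :
  (0 <= mutual_info mu Q)%E.
Proof.
apply: ereal_sup_ubound; exists 1, 1, (fun=> setT), (fun=> setT).
have part d (T : measurableType d) : finite_partition (fun _ : 'I_1 => [set: T]).
  split=> // [i j|]; first by rewrite !ord1 eqxx.
  by apply/seteqP; split=> // x _; exists ord0.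
split=> //; rewrite !big_ord1 joint_rectE // setXTT -outputE !probability_setT.
apply/esym; congr (_%:E)%E; transitivity (mi_term (R := R) 1 1 1).
  by rewrite [X in mi_term _ (fine X) _](_ : _ = 1%E) //; exact: probability_setT.
by rewrite /mi_term oner_eq0 !mul1r invr1 /log2 ln1 mul0r.
Qed.

Section conditional_entropy.
Context {R : realType} {dX dY dZ : measure_display} {X : measurableType dX}
  {Y : measurableType dY} {Z : measurableType dZ}.
Variables (mu : probability X R) (Q : R.-pker X ~> Y) (I Ibar : R).
Hypothesis IE : mutual_info mu Q = I%:E.
Hypothesis I_le : I <= Ibar.
Hypothesis Ibar0 : 0 <= Ibar.
Hypothesis mY1 : forall y : Y, measurable [set y].
Variables (rho : probability Y R) (n : nat) (f : X * Y -> R).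
Hypothesis n0 : (0 < n)%N.
Hypothesis mf : measurable_fun setT f.
Hypothesis f0 : forall p, (0 <= f p)%R.
Variables (PZ : probability Z R) (c : nat -> Z -> Y * measurableTypeR R).
Hypothesis mc : forall i, measurable_fun setT (c i).
Local Open Scope ereal_scope.
Hypothesis f1 : forall x, \int[rho]_y (f (x, y))%:E = 1.
Hypothesis out_le : forall B, measurable B -> output mu Q B <= n%:R%:E * rho B.
Hypothesis fE : forall C, measurable C ->
  joint mu Q C = \int[mu]_x \int[rho]_(y in xsection C x) (f (x, y))%:E.
Hypothesis PZ_rect : forall N (B : nat -> set (Y * measurableTypeR R)),
  (forall i, measurable (B i)) ->
  PZ [set z | forall i, (i < N)%N -> B i (c i z)] = \prod_(i < N) marked rho (B i).

Local Notation L := (Ibar + 8 / 5)%R.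
Local Notation w i := (- log2 (index_weight L n i))%R.
Local Notation cost := (sel_cost rho f c (fun i => (w i)%:E)).
Local Notation g := (sel_value rho f c).

Let L0 : (0 < L)%R. Proof. by move: Ibar0; lra. Qed.

Let l20 : (0 <= ln 2 :> R)%R. Proof. by rewrite ltW // ln2_gt0. Qed.

Let n0' : (0 < n%:R :> R)%R. Proof. by rewrite ltr0n. Qed.

(** Being affine in [ln (1 + i / n)], the cost has an expectation controlled by [sum_pick_prob_eq1]
    and [sum_index_cost]. *)
Lemma weight_costE i :
  (w i = log2 (n%:R * (1 + L)) + (1 + L^-1) / ln 2 * ln (1 + i%:R / n%:R))%R.
Proof.
have nL : (0 < n%:R * (1 + L))%R by rewrite mulr_gt0 //; move: L0; lra.
rewrite /log2 /index_weight ln_div ?posrE ?expR_gt0 // expRK.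
by ring.
Qed.

Let A0 : (0 <= log2 (n%:R * (1 + L)))%R.
Proof.
rewrite /log2 divr_ge0 //  ln_ge0 //.
have n1 : (1 <= n%:R :> R)%R by rewrite ler1n.
have := L0; nra.
Qed.

Let B0 : (0 <= (1 + L^-1) / ln 2)%R.
Proof. by rewrite divr_ge0 //  addr_ge0 // invr_ge0 ltW. Qed.

Let w0 i : (0 <= w i)%R.
Proof. by rewrite weight_costE addr_ge0 // mulr_ge0 // ln_index_ge0. Qed.

Let w0' i : 0 <= (w i)%:E. Proof. by rewrite lee_fin. Qed.

Let mcost : measurable_fun setT cost. Proof. exact: measurable_sel_cost. Qed.

Let cost0 p : 0 <= cost p. Proof. exact: (sel_cost_ge0 rho f c p w0'). Qed.

Lemma entropy_le_integral_cost z :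
  entropy (pushforward mu (fun x => g (x, z))) <= \int[mu]_x cost (x, z).
Proof.
pose D i := ysection (Sel rho f c i) z.
have DE i x : D i x -> Sel rho f c i (x, z) by rewrite /D ysectionE.
apply: (@entropy_le_cost _ _ _ _ _ mu _ D (fun i => (c i z).1) (index_weight L n)) => //.
- apply: (measurableT_comp _ (pair2_measurable z)); exact: measurable_sel_value.
- by move=> i; apply: measurable_ysection; exact: measurable_Sel.
- by apply: trivIset_ysection; exact: trivIset_Sel.
- by move=> i x /DE; exact: sel_valueE.
- by move=> i; exact: index_weight_gt0.
- apply: lime_le.
    by apply: is_cvg_nneseries => i _ _; rewrite lee_fin ltW // index_weight_gt0.
  by apply: nearW => N; rewrite big_mkord sumEFin lee_fin sum_index_weight_le1.
- exact: (measurableT_comp mcost (pair2_measurable z)).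
- by move=> i x /DE; exact: sel_costE.
- move=> x xD; rewrite /sel_cost; case: pselect => // nS; exfalso; apply: nS => -[i _ Si].
  by apply: xD; exists i => //; rewrite /D ysectionE.
Qed.

Local Notation P x := (\int[rho]_y (n%:R * Psi (f (x, y) / n%:R))%:E).

Let mfx x : measurable_fun setT (fun y => f (x, y)).
Proof. exact: (measurableT_comp mf (pair1_measurable x)). Qed.

Lemma integral_cost_le x : \int[PZ]_z cost (x, z) <=
  (log2 (n%:R * (1 + L)))%:E + ((1 + L^-1) / ln 2)%:E * (2^-1%:E + P x).
Proof.
rewrite integral_sel_cost //.
set p := pick_prob _ _.
have p0 i : (0 <= p i)%R by exact: pick_prob_ge0.
have S := @sum_index_cost _ _ _ rho _ (mfx x) (fun y => f0 (x, y)) (f1 x) n n0.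
have := @sum_pick_prob_eq1 _ _ _ rho _ (mfx x) (fun y => f0 (x, y)) (f1 x).
rewrite -/p => p1.
rewrite (eq_eseriesr (g := fun i => (log2 (n%:R * (1 + L)))%:E * (p i)%:E +
  ((1 + L^-1) / ln 2)%:E * (p i * ln (1 + i%:R / n%:R))%:E)); last first.
  move=> i _; rewrite weight_costE -!EFinM -EFinD; congr (_%:E); ring.
rewrite nneseriesD; last 2 first.
- by move=> i _ _; rewrite -EFinM lee_fin mulr_ge0.
- by move=> i _ _; rewrite -EFinM lee_fin mulr_ge0 // mulr_ge0 // ln_index_ge0.
rewrite !nneseriesZl; last 2 first.
- by move=> i _; rewrite lee_fin mulr_ge0 // ln_index_ge0.
- by move=> i _; rewrite lee_fin.
rewrite p1 mule1; apply: leeD2l; apply: lee_wpmul2l; first by rewrite lee_fin.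
move: S; rewrite -/p.
move: (\sum_(i <oo) _) (P x) => s t h.
have -> : s = s + 1 - 1 by rewrite addeK.
rewrite leeBlDr //; apply: le_trans h _.
by rewrite addeAC -EFinD; apply: leeD2r; rewrite lee_fin; lra.
Qed.

Lemma cond_entropy_le :
  cond_entropy_fr mu PZ g <= (Ibar + log2 (n%:R * (Ibar + 1)) + 4)%:E.
Proof.
have mnPsi : measurable_fun setT (fun p => n%:R * Psi (f p / n%:R))%R.
  apply: measurable_funM => //; apply: (measurableT_comp measurable_Psi).
  exact: measurable_funM.
have Psi0 p : 0 <= (n%:R * Psi (f p / n%:R))%:E by rewrite lee_fin mulr_ge0 ?Psi_ge0.
have P0 x : 0 <= P x by exact: integral_ge0.
have mnPsiE : measurable_fun setT (fun p => (n%:R * Psi (f p / n%:R))%:E).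
  exact/measurable_EFinP.
have mP : measurable_fun setT (fun x => P x).
  exact: (measurable_fun_fubini_tonelli_F (m2 := rho) _ mnPsiE Psi0).
have fE' C : measurable C -> joint mu Q C = \int[mu \x rho]_(p in C) (f p)%:E.
  by move=> mC; rewrite fE // integral_product_xsection //; exact/measurable_EFinP.
have IP : \int[mu]_x P x <= (I * ln 2 + 16^-1 + 2^-1)%:E.
  by have := integral_Psi_le IE n0 mf f0 out_le fE'; rewrite fubini_tonelli1.
apply: (@le_trans _ _ (\int[PZ]_z \int[mu]_x cost (x, z))).
  by apply: integral_le_majorant => z; [exact: entropy_le_integral_cost | apply: integral_ge0].
(* The entropy is bounded for fixed [z], whereas the expected index is controlled for fixed [x];
   exchanging the integrals connects the two. *)
rewrite -fubini_tonelli //.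
apply: (@le_trans _ _ (\int[mu]_x
    ((log2 (n%:R * (1 + L)))%:E + ((1 + L^-1) / ln 2)%:E * (2^-1%:E + P x)))).
  apply: integral_le_majorant => x; first exact: integral_cost_le.
  by rewrite adde_ge0 ?lee_fin // mule_ge0 ?lee_fin // adde_ge0 ?lee_fin.
have cst_int (r : R) : \int[mu]_x r%:E = r%:E.
  by rewrite integral_cst // [X in _ * X]probability_setT mule1.
have hP0 x : 0 <= 2^-1%:E + P x by rewrite adde_ge0 ?lee_fin.
have mhP : measurable_fun setT (fun x => 2^-1%:E + P x) by exact: emeasurable_funD.
rewrite ge0_integralD //; last 2 first.
- by move=> x _; rewrite mule_ge0 ?lee_fin.
- exact: emeasurable_funM.
rewrite ge0_integralZl_EFin // ge0_integralD //.
rewrite !cst_int.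
apply: (@le_trans _ _ ((log2 (n%:R * (1 + L)))%:E +
    ((1 + L^-1) / ln 2)%:E * (2^-1%:E + (I * ln 2 + 16^-1 + 2^-1)%:E))).
  by apply: leeD2l; apply: lee_wpmul2l; [rewrite lee_fin | apply: leeD2l].
rewrite -(EFinD (2^-1)%R) -EFinM -(EFinD (log2 _)) lee_fin.
apply: le_trans (total_cost_le Ibar0 n0); rewrite lerD2l -mulrA ler_wpM2l //.
  by rewrite addr_ge0 // invr_ge0 ltW.
have -> : (2^-1 + (I * ln 2 + 16^-1 + 2^-1) = 1 + 16^-1 + I * ln 2)%R by lra.
by rewrite mulrC; apply: le_trans (bits_le I) _; rewrite lerD2r.
Qed.

End conditional_entropy.

Theorem theorem1 (R : realType) (dX dY : measure_display)
  (X : measurableType dX) (Y : measurableType dY)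
  (polX : polish_space R X) (polY : polish_space R Y)
  (n : nat) (n_gt0 : (0 < n)%N) (mu : 'I_n -> probability X R)
  (mu_inj : injective mu)
  (Q : R.-pker X ~> Y)
  (Ifin : forall a : 'I_n, (mutual_info (mu a) Q < +oo)%E) :
  let Ibar : R := fine (\big[Order.max/(-oo)%E]_(a < n) mutual_info (mu a) Q) in
  exists (dZ : measure_display) (Z : measurableType dZ)
         (PZ : probability Z R) (g : X * Z -> Y),
    measurable_fun [set: X * Z] g /\
    forall a : 'I_n,
      (forall C : set (X * Y), measurable C ->
         ((mu a \x PZ)%E [set p | C (p.1, g p)] = joint_law (mu a) Q C)) /\
      (cond_entropy_fr (mu a) PZ g <=
         (Ibar + log2 (n%:R * (Ibar + 1)) + 4)%:E)%E.
Proof.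
case: n n_gt0 mu mu_inj Ifin => // n _ mu _ Ifin Ibar.
have MI0 a : (0%:E <= mutual_info (mu a) Q)%E.
  exact: mutual_info_ge0.
have MIE a : (mutual_info (mu a) Q = (fine (mutual_info (mu a) Q))%:E)%E.
  by rewrite fineK // ge0_fin_numE.
(* The finite family is extended to all natural numbers; the average reads only the indices below
   [n.+1], where [nu] agrees with [mu]. *)
pose nu k := mu (inord k).
have nuE (a : 'I_n.+1) : nu a = mu a by rewrite /nu inord_val.
(* A maximum of finitely many finite values over a nonempty index set is finite, so [fine] loses
   nothing in [Ibar]. *)
have maxE : (\big[Order.max/(-oo)]_(a < n.+1) mutual_info (mu a) Q = Ibar%:E)%E.
  rewrite fineK // ge0_fin_numE.
    by apply: bigmax_lt => // a _.
  exact: le_trans (MI0 ord0) (le_bigmax _ _ _).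
have I_le a : fine (mutual_info (mu a) Q) <= Ibar.
  by rewrite -lee_fin -MIE -maxE; exact: le_bigmax.
have Ibar0 : 0 <= Ibar by apply: le_trans (I_le ord0); rewrite -lee_fin -MIE.
have IE k : mutual_info (nu k) Q = (fine (mutual_info (nu k) Q))%:E := MIE (inord k).
have [f [mf f0 f1 fE]] := exists_common_density n IE.
have [dZ [Z [PZ [c [mc PZ_rect]]]]] := iid_sequence (marked (reference nu Q n)).
pose g := sel_value (reference nu Q n) f c.
have mg : measurable_fun setT g by exact: measurable_sel_value.
exists dZ, Z, PZ, g; split=> // a; split=> [C mC|].
  transitivity (\int[mu a]_x \int[reference nu Q n]_(y in xsection C x) (f (x, y))%:E)%E.
    apply: eq_integral => x _.
    rewrite -(sel_value_law mf f0 f1 mc PZ_rect); last exact: measurable_xsection.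
    by congr (PZ _); apply/seteqP; split=> z; rewrite /xsection /= !inE.
  by rewrite -jointE -nuE fE.
rewrite -nuE.
apply: (cond_entropy_le (IE a)) => //.
- by rewrite nuE.
- by move=> y; exact: polish_singleton polY.
- by move=> B mB; exact: output_le_reference.
- by move=> C mC; exact: fE.
Qed.
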